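(* Let $X$ be a micro-transitive complex Banach space and let $Y$ be a $\mathbb{C}$-uniformly convex complex Banach space. Then the pair $(c_0(X),Y)$ has the property $\mathbf{L}_{p,p}$. That is, for each $\varepsilon>0$ and each $x_0\in S_{c_0(X)}$ there exists $\eta(\varepsilon,x_0)>0$ such that whenever $T\in S_{\mathcal{L}(c_0(X),Y)}$ satisfies $\|Tx_0\|>1-\eta(\varepsilon,x_0)$, there exists $S\in S_{\mathcal{L}(c_0(X),Y)}$ with $$\|Sx_0\|=1\quad\text{and}\quad\|S-T\|<\varepsilon.$$
   Context: For a Banach space $Z$, $S_Z$ denotes its unit sphere. $\mathcal{L}(Z,Y)$ is the space of bounded linear operators from $Z$ to $Y$ with the operator norm. $c_0(X)=\bigl[\oplus_{i=1}^\infty X\bigr]_{c_0}$ is the space of sequences $x=(x(i))_{i\in\mathbb{N}}$ in $X$ with $\|x(i)\|\to 0$, normed by $\|x\|=\sup_i\|x(i)\|$. A Banach space $X$ is micro-transitive if for every $\varepsilon>0$ there exists $0<\theta(\varepsilon)<\varepsilon$ such that whenever $x,y\in S_X$ satisfy $\|x-y\|<\theta(\varepsilon)$, there exists a linear isometry $U\colon X\to X$ such that $Ux=y$ and $\|U-I\|<\varepsilon$, where $I$ is the identity operator on $X$. A complex Banach space $Y$ is $\mathbb{C}$-uniformly convex if for every $\varepsilon>0$ the modulus of $\mathbb{C}$-convexity $$\delta_{\mathbb{C}}(\varepsilon):=\inf_{x,y\in S_Y}\Bigl\{\sup_{\lambda\in\mathbb{C},\,|\lambda|=1}\|x+\lambda\varepsilon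 y\|-1\Bigr\}$$ is strictly positive. *)

(* Defs.v *)
From HB Require Import structures.
From mathcomp Require Import all_boot all_order all_algebra.
From mathcomp Require Import all_classical all_reals all_analysis.
From mathcomp Require Export complex.

Set Implicit Arguments.
Unset Strict Implicit.
Unset Printing Implicit Defensive.

Import Order.TTheory GRing.Theory Num.Theory.
Import numFieldNormedType.Exports.

Local Open Scope classical_set_scope.
Local Open Scope complex_scope.
Local Open Scope ring_scope.

(* The norm of a [normedModType R[i]] takes its values in [R[i]], where it is a
   nonnegative real number; [rnorm] is that number as an element of [R]. *)
Definition rnorm (R : realType) (V : normedModType R[i]) (x : V) : R :=
  complex.Re `|x|.

Section RealNorm.
Context {R : realType} {V : normedModType R[i]}.
Implicit Types x y : V.

Lemma rnormE x : (rnorm x)%:C = `|x|.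
Proof.
rewrite /rnorm; case: (`|x|) (normr_ge0 x) => a b.
by rewrite lecE => /andP[/= /eqP -> _].
Qed.

Lemma rnorm_ge0 x : 0 <= rnorm x.
Proof. by have := normr_ge0 x; rewrite lecE => /andP[]. Qed.

Lemma ler_rnormD x y : rnorm (x + y) <= rnorm x + rnorm y.
Proof. by rewrite -lecR rmorphD/= !rnormE ler_normD. Qed.

Lemma rnormZ (l : R[i]) x : rnorm (l *: x) = complex.Re `|l| * rnorm x.
Proof.
by apply: complexI; rewrite rmorphM/= !rnormE normrZ.
Qed.

Lemma rnorm0 : rnorm (0 : V) = 0.
Proof. by rewrite /rnorm normr0. Qed.

Lemma rnorm_eq0 x : rnorm x = 0 -> x = 0.
Proof. by move=> x0; apply/normr0_eq0; rewrite -rnormE x0. Qed.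

End RealNorm.

Section C0.
Context {R : realType} {X : normedModType R[i]}.

Definition c0_pred : {pred nat -> X} :=
  [pred u : nat -> X | `[< (fun i => rnorm (u i)) @ \oo --> (0 : R) >]].

Lemma c0_submod_closed : submod_closed c0_pred.
Proof.
split=> [|l u v]; rewrite !inE; last move=> u0 v0.
  rewrite (_ : (fun _ => _) = cst 0); first exact: cvg_cst.
  by apply/funext => i; exact: rnorm0.
apply: (@squeeze_cvgr _ _ _ _ (cst 0)
  (fun i => complex.Re `|l| * rnorm (u i) + rnorm (v i))).
- near=> i; rewrite /= rnorm_ge0/=.
  by rewrite (le_trans (ler_rnormD _ _))// rnormZ.
- exact: cvg_cst.
- rewrite [X in _ --> X](_ : 0 = complex.Re `|l| * 0 + 0); last first.
    by rewrite mulr0 addr0.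
  by apply: cvgD v0; apply: cvgM u0; exact: cvg_cst.
Unshelve. all: end_near. Qed.

HB.instance Definition _ :=
  GRing.isSubmodClosed.Build R[i] (nat -> X) c0_pred c0_submod_closed.

End C0.

Record c0 (R : realType) (X : normedModType R[i]) :=
  C0 { c0_seq :> nat -> X; _ : c0_seq \in c0_pred }.

Section C0_Normed.
Context {R : realType} {X : normedModType R[i]}.

HB.instance Definition _ := [isSub for @c0_seq R X].
HB.instance Definition _ := [Choice of c0 X by <:].
HB.instance Definition _ := [SubChoice_isSubLmodule of c0 X by <:].

Implicit Types x y : c0 X.

Lemma c0_cvg x : (fun i => rnorm (x i)) @ \oo --> (0 : R).
Proof. by case: x => u /=; rewrite inE. Qed.

Definition c0_norm (x : c0 X) : R := sup (range (fun i => rnorm (x i))).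

Lemma c0_has_sup x : has_sup (range (fun i => rnorm (x i))).
Proof.
split; first by exists (rnorm (x 0%N)), 0%N.
have : cvgn (fun i => rnorm (x i)) by apply/cvg_ex; exists 0; exact: c0_cvg.
move=> /cvg_seq_bounded[M [_ /(_ (M + 1))]].
rewrite ltrDl ltr01 => /(_ erefl) xM.
exists (M + 1) => _ [i _ <-].
by rewrite (le_trans (ler_norm _))// xM.
Qed.

Lemma c0_norm_ub x i : rnorm (x i) <= c0_norm x.
Proof. by apply: ub_le_sup; [exact: (c0_has_sup x).2|exists i]. Qed.

Lemma c0_norm_le x (M : R) : (forall i, rnorm (x i) <= M) -> c0_norm x <= M.
Proof.
move=> xM; apply: ge_sup; first exact: (c0_has_sup x).1.
by move=> _ [i _ <-].
Qed.

Let norm x : R[i] := (c0_norm x)%:C.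

Let ler_normD x y : norm (x + y) <= norm x + norm y.
Proof.
rewrite /norm -rmorphD lecR; apply: c0_norm_le => i.
by rewrite (le_trans (ler_rnormD _ _))// lerD// c0_norm_ub.
Qed.

Let c0_normZ_le (l : R[i]) x : c0_norm (l *: x) <= complex.Re `|l| * c0_norm x.
Proof.
apply: c0_norm_le => i; rewrite rnormZ ler_wpM2l ?c0_norm_ub//.
by rewrite normc_def/= sqrtr_ge0.
Qed.

Let normrZ (l : R[i]) x : norm (l *: x) = `|l| * norm x.
Proof.
have lE (k : R[i]) : `|k| = (complex.Re `|k|)%:C by rewrite normc_def.
rewrite /norm lE -rmorphM; congr (_%:C); apply/eqP.
rewrite eq_le c0_normZ_le andTb.
have [->|l0] := eqVneq l 0.
  rewrite normr0 raddf0 mul0r scale0r.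
  by rewrite (le_trans _ (c0_norm_ub 0 0%N))// rnorm_ge0.
have l_gt0 : 0 < complex.Re `|l| by rewrite -ltcR -lE normr_gt0.
rewrite mulrC -ler_pdivlMr//.
rewrite -{1}(scale1r x) -(mulVf l0) -scalerA (le_trans (c0_normZ_le _ _))//.
rewrite mulrC ler_wpM2l//.
  by rewrite (le_trans _ (c0_norm_ub _ 0%N))// rnorm_ge0.
by rewrite -lecR fmorphV/= -!lE normfV.
Qed.

Let normr0_eq0 x : norm x = 0 -> x = 0.
Proof.
move=> [x0]; apply/val_inj/funext => i /=; apply/rnorm_eq0/eqP.
by rewrite eq_le rnorm_ge0 -x0 c0_norm_ub.
Qed.

HB.instance Definition _ :=
  Lmodule_isNormed.Build R[i] (c0 X) ler_normD normrZ normr0_eq0.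

Lemma c0_rnormE x : rnorm x = sup (range (fun i => rnorm (x i))).
Proof. by []. Qed.

End C0_Normed.

Definition sphere (R : realType) (V : normedModType R[i]) : set V :=
  [set x | rnorm x = 1].
Arguments sphere {R} V.

(* Operator norm, with value +oo on unbounded maps; taking the supremum over the
   closed unit ball gives the value 0 when [Z] is the trivial space. *)
Definition opnorm (R : realType) (Z Y : normedModType R[i]) (T : Z -> Y) :
    \bar R :=
  ereal_sup [set (rnorm (T z))%:E | z in [set z | rnorm z <= 1]].

Definition op_sphere (R : realType) (Z Y : normedModType R[i])
    (T : {linear Z -> Y}) : Prop :=
  continuous T /\ opnorm T = 1%:E.

Definition micro_transitive (R : realType) (X : normedModType R[i]) :=
  forall e : R, 0 < e -> exists theta : R, 0 < theta < e /\
    forall x y : X, sphere X x -> sphere X y -> rnorm (x - y) < theta ->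
      exists U : {linear X -> X},
        [/\ forall z, rnorm (U z) = rnorm z, U x = y &
            (opnorm (U \- idfun)%R < e%:E)%E].
Arguments micro_transitive {R} X.

Definition modulus_Cconvexity (R : realType) (Y : normedModType R[i]) (e : R) :
    \bar R :=
  let sup_circle (x y : Y) := ereal_sup
    [set (rnorm (x + (l * e%:C) *: y))%:E | l in [set l : R[i] | `|l| = 1]] in
  ereal_inf [set (sup_circle p.1 p.2 - 1)%E | p in sphere Y `*` sphere Y].
Arguments modulus_Cconvexity {R} Y e.

Definition C_uniformly_convex (R : realType) (Y : normedModType R[i]) :=
  forall e : R, 0 < e -> (0 < modulus_Cconvexity Y e)%E.
Arguments C_uniformly_convex {R} Y.

Definition property_Lpp (R : realType) (Z Y : normedModType R[i]) :=
  forall e : R, 0 < e -> forall z0 : Z, sphere Z z0 ->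
    exists eta : R, 0 < eta /\
      forall T : {linear Z -> Y}, op_sphere T -> rnorm (T z0) > 1 - eta ->
        exists S : {linear Z -> Y},
          [/\ op_sphere S, rnorm (S z0) = 1 &
              (opnorm (S \- T)%R < e%:E)%E].
Arguments property_Lpp {R} Z Y.

(* Main.v *)
Require Import Defs.
From HB Require Import structures.
From mathcomp Require Import all_boot all_order all_algebra.
From mathcomp Require Import all_classical all_reals all_analysis.
From mathcomp Require Import ring lra.

(* A micro-transitive space X is uniformly smooth: along a short segment
   s |-> |x + s y| the second differences add up to a bounded quantity, so some
   nearby point has a small one, and an isometry close to the identity carries
   it back to x.  Uniform smoothness makes the unit ball dentable, that is, some
   slice is small; since the isometry group is transitive on the sphere, X is
   then uniformly convex.

   Let F be the finite set of coordinates at which x0 has norm 1.  As the other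
   coordinates of x0 stay away from norm 1 and Y is C-uniformly convex, T is
   small off F, so T may be replaced by its restriction to F.  By uniform
   convexity of X, a small rank-one perturbation of T can only be almost normed
   near the circle through x0, and isometries of X acting on the coordinates in
   F and close to the identity move such an almost norming point back to x0.
   This makes x0 almost norming to any prescribed precision, at a cost
   controlled by the previous precision.  Iterating gives a Cauchy sequence of
   operators whose limit attains its norm at x0. *)

Set Implicit Arguments.
Unset Strict Implicit.
Unset Printing Implicit Defensive.

Import Order.TTheory GRing.Theory Num.Theory.
Import numFieldNormedType.Exports.

Local Open Scope classical_set_scope.
Local Open Scope complex_scope.
Local Open Scope ring_scope.

(** * Sublinear functionals and the Hahn-Banach theorem *)

Section ScalarFunctions.
Context {K : nzRingType} {V : lmodType K}.
Implicit Types (f : V -> K) (x y : V).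

Lemma scalarDZ f x y (a : K) : scalar f -> f (x + a *: y) = f x + a * f y.
Proof. by move=> sf; rewrite addrC sf addrC. Qed.

Lemma scalar_fun0 f : scalar f -> f 0 = 0.
Proof.
move=> sf; apply: (addrI (f 0)).
by have := sf 1 0 0; rewrite scaler0 !addr0 mul1r.
Qed.

Lemma scalar_funZ f x (a : K) : scalar f -> f (a *: x) = a * f x.
Proof. by move=> sf; have := sf a x 0; rewrite scalar_fun0// !addr0. Qed.

Lemma scalar_funD f x y : scalar f -> f (x + y) = f x + f y.
Proof. by move=> sf; have := sf 1 x y; rewrite scale1r mul1r. Qed.

Lemma scalar_funB f x y : scalar f -> f (x - y) = f x - f y.
Proof. by move=> sf; rewrite -scaleN1r scalarDZ// mulN1r. Qed.

Lemma scalar_funN f x : scalar f -> f (- x) = - f x.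
Proof. by move=> sf; rewrite -sub0r scalar_funB// scalar_fun0// sub0r. Qed.

End ScalarFunctions.

Section HahnBanach.
Context {R : realType} {V : lmodType R}.
Implicit Types (p q : V -> R) (v x y : V).

(** Homogeneity is stated as an inequality so that it passes to infima; applied also to [a^-1] it
    becomes an equality for [a > 0]. *)
Definition sublinear q :=
  (forall x y, q (x + y) <= q x + q y) /\
  (forall a x, 0 <= a -> q (a *: x) <= a * q x).

Lemma sublinear0 q : sublinear q -> q 0 = 0.
Proof.
move=> [qD qZ]; apply/eqP; rewrite eq_le.
have := qZ 0 0 (lexx _); rewrite scale0r mul0r => ->/=.
by have := qD 0 0; rewrite addr0; lra.
Qed.

Lemma sublinear_opp q x : sublinear q -> - q (- x) <= q x.
Proof.
move=> sq; have := sq.1 x (- x).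
by rewrite subrr sublinear0//; lra.
Qed.

(** Directedness makes the pointwise infimum subadditive: members used at [x] and at [y] have a
    common lower one. The infimum is finite because [- p (- x) <= r x] for every member [r]. This
    gives the lower bounds of chains for Zorn's lemma. *)
Lemma sublinear_inf (A : set (V -> R)) p : sublinear p -> A !=set0 ->
  (forall q, A q -> sublinear q /\ forall x, q x <= p x) ->
  (forall q1 q2, A q1 -> A q2 ->
    exists2 q, A q & forall x, q x <= q1 x /\ q x <= q2 x) ->
  exists2 q, sublinear q & forall r x, A r -> q x <= r x.
Proof.
move=> sp [q0 Aq0] Ap dA.
pose E x := [set r x | r in A].
have infE x : has_inf (E x).
  split; first by exists (q0 x), q0.
  exists (- p (- x)) => _ [r Ar <-].
  have [sr rp] := Ap _ Ar.
  by rewrite (le_trans _ (sublinear_opp x sr))// lerN2.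
have infle r x : A r -> inf (E x) <= r x.
  by move=> Ar; apply: ge_inf; [exact: (infE x).2|exists r].
exists (fun x => inf (E x)) => //; split.
- move=> x y; rewrite -lerBlDr; apply: lb_le_inf; first exact: (infE x).1.
  move=> _ [r Ar <-]; rewrite lerBlDr -lerBlDl.
  apply: lb_le_inf; first exact: (infE y).1.
  move=> _ [s As <-]; rewrite lerBlDl.
  have [q Aq qrs] := dA _ _ Ar As.
  rewrite (le_trans (infle q _ Aq))// (le_trans ((Ap _ Aq).1.1 _ _))//.
  by rewrite lerD// ?(qrs _).1 ?(qrs _).2.
- move=> a x; rewrite [0 <= a]le_eqVlt => /predU1P[<-|a0].
    rewrite mul0r scale0r (le_trans (infle _ _ Aq0))//.
    by rewrite sublinear0//; exact: (Ap _ Aq0).1.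
  rewrite mulrC -ler_pdivrMr//; apply: lb_le_inf; first exact: (infE x).1.
  move=> _ [r Ar <-]; rewrite ler_pdivrMr// mulrC.
  by rewrite (le_trans (infle r _ Ar))// (Ap _ Ar).1.2// ltW.
Qed.

(** [q'] is the infimum over [t >= 0] of [q (x + t v) - t q v]; [t = 0] and [t = 1] give the two
    bounds. At [- v] the second one reads [q' (- v) <= - q v], which forces any linear functional
    below [q'] to agree with [q] at [v]. *)
Lemma sublinear_descent q v : sublinear q ->
  exists q', [/\ sublinear q', forall x, q' x <= q x &
                 forall x, q' x <= q (x + v) - q v].
Proof.
move=> sq; pose E x := [set q (x + t *: v) - t * q v | t in [set t | 0 <= t]].
have infE x : has_inf (E x).
  split; first by exists (q (x + 0 *: v) - 0 * q v), 0 => /=.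
  exists (- q (- x)) => _ [t t0 <-].
  have := sq.1 (x + t *: v) (- x); rewrite addrAC subrr add0r.
  suff : q (t *: v) = t * q v by lra.
  apply/eqP; rewrite eq_le sq.2//=.
  move: t0; rewrite /= [0 <= t]le_eqVlt => /predU1P[<-|t0].
    by rewrite mul0r scale0r sublinear0.
  have := sq.2 t^-1 (t *: v); rewrite invr_ge0 ltW// => /(_ isT).
  by rewrite scalerA mulVf ?gt_eqF// scale1r ler_pdivlMl.
have infle t x : 0 <= t -> inf (E x) <= q (x + t *: v) - t * q v.
  by move=> t0; apply: ge_inf; [exact: (infE x).2|exists t].
exists (fun x => inf (E x)); split.
- split=> [x y|a x].
  + rewrite -lerBlDr; apply: lb_le_inf; first exact: (infE x).1.
    move=> _ [s /= s0 <-]; rewrite lerBlDr -lerBlDl.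
    apply: lb_le_inf; first exact: (infE y).1.
    move=> _ [t /= t0 <-]; rewrite lerBlDl.
    rewrite (le_trans (infle (s + t) _ _)) ?addr_ge0//.
    have := sq.1 (x + s *: v) (y + t *: v).
    by rewrite addrACA -scalerDl; lra.
  + rewrite [0 <= a]le_eqVlt => /predU1P[<-|a0].
      rewrite mul0r scale0r (le_trans (infle 0 _ _))//.
      by rewrite scale0r addr0 mul0r sublinear0// subr0.
    rewrite mulrC -ler_pdivrMr//; apply: lb_le_inf; first exact: (infE x).1.
    move=> _ [t /= t0 <-]; rewrite ler_pdivrMr//.
    rewrite (le_trans (infle (a * t) _ (mulr_ge0 (ltW a0) t0)))//.
    have := sq.2 a (x + t *: v) (ltW a0).
    rewrite scalerDr scalerA; lra.
- by move=> x; rewrite (le_trans (infle 0 x _))// scale0r addr0 mul0r subr0.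
- by move=> x; rewrite (le_trans (infle 1 x _))// scale1r mul1r.
Qed.

(* A minimal sublinear functional below [p] is additive: otherwise
   [sublinear_descent] would produce a smaller one. *)
Lemma sublinear_dominates_linear p : sublinear p ->
  exists2 f : V -> R, scalar f & forall x, f x <= p x.
Proof.
move=> sp.
pose T := {q : V -> R | `[< sublinear q /\ forall x, q x <= p x >]}.
(* The order is reversed, so that a maximal element is a minimal functional. *)
pose le_rev (q r : T) := `[< forall x, sval r x <= sval q x >].
have Tp : `[< sublinear p /\ forall x, p x <= p x >] by apply/asboolP.
have [| | |q qmin] := @ZL_preorder T (exist _ p Tp) le_rev.
- by move=> t; apply/asboolP.
- move=> r s t /asboolP rs /asboolP st; apply/asboolP => x.
  exact: le_trans (rs x).
- move=> A tA; have [[t0 At0]|A0] := pselect (A !=set0); last first.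
    by exists (exist _ p Tp) => s As; exfalso; apply: A0; exists s.
  have [| | |q sq qA] :=
    @sublinear_inf [set sval t | t in A] p sp.
  + by exists (sval t0), t0.
  + by move=> _ [r Ar <-]; have /asboolP := svalP r.
  + move=> _ _ [r Ar <-] [s As <-].
    by case: (tA _ _ Ar As) => /asboolP h; [exists (sval s)|exists (sval r)];
       by [exists s|exists r|move=> x; split].
  + have Tq : `[< sublinear q /\ forall x, q x <= p x >].
      apply/asboolP; split => // x.
      apply: (@le_trans _ _ (sval t0 x)); first by apply: qA; exists t0.
      by have /asboolP[_] := svalP t0.
    by exists (exist _ q Tq) => s As; apply/asboolP => x; apply: qA; exists s.
have /asboolP[sq qp] := svalP q; exists (sval q) => //.
have qD x y : sval q (x + y) = sval q x + sval q y.
  apply/eqP; rewrite eq_le sq.1/=.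
  have [q' [sq' q'q q'v]] := sublinear_descent y sq.
  have Tq' : `[< sublinear q' /\ forall x, q' x <= p x >].
    by apply/asboolP; split => // z; exact: le_trans (qp z).
  have /asboolP/(_ x)/= := qmin (exist _ q' Tq') (asboolT q'q).
  by have := q'v x; lra.
have qN x : sval q (- x) = - sval q x.
  by have := qD x (- x); rewrite subrr sublinear0//; lra.
have qZ a x : 0 <= a -> sval q (a *: x) = a * sval q x.
  move=> a0; apply/eqP; rewrite eq_le sq.2//=.
  by have := sq.2 a (- x) a0; rewrite scalerN !qN mulrN lerN2.
move=> a x y; rewrite qD; congr (_ + _).
have [|/ltW a0] := leP 0 a; first exact: qZ.
rewrite -[a in LHS]opprK scaleNr qN qZ; last by rewrite oppr_ge0.
by rewrite mulNr opprK.
Qed.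

Lemma Hahn_Banach_sublinear p v : sublinear p ->
  exists f : V -> R, [/\ scalar f, forall x, f x <= p x & f v = p v].
Proof.
move=> sp; have [q [sq qp qv]] := sublinear_descent v sp.
have [f sf fq] := sublinear_dominates_linear sq.
exists f; split => // [x|]; first exact: le_trans (qp x).
apply/eqP; rewrite eq_le (le_trans (fq v))//=.
have := le_trans (fq (- v)) (qv (- v)).
by rewrite addNr sublinear0// scalar_funN//; lra.
Qed.

End HahnBanach.

(** * Uniform smoothness and dentability *)

Section UniformSmoothness.
Context {R : realType} {V : normedModType R}.
Implicit Types (x y z u v : V) (S : set V) (FF : set (set V)).

(** A single [t] is enough for each [w]: by convexity of the norm, the second difference divided by
    [t] is nondecreasing in [t], so the bound persists for smaller steps. *)
Definition uniformly_smooth (W : normedModType R) :=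
  forall w : R, 0 < w -> exists2 t : R, 0 < t &
    forall x y : W, `|y| <= `|x| ->
      `|x + t *: y| + `|x - t *: y| <= (2 + w * t) * `|x|.

(** The base point is the midpoint: in this form a failure at one unit vector is carried to all
    others by a transitive isometry group. *)
Definition uniformly_convex (W : normedModType R) :=
  forall e : R, 0 < e -> exists2 d : R, 0 < d &
    forall x y : W, `|x| = 1 -> `|x + y| <= 1 + d -> `|x - y| <= 1 + d ->
      `|y| < e.

Definition transitive_sphere (W : normedModType R) :=
  forall x y : W, `|x| = 1 -> `|y| = 1 ->
    exists2 U : {linear W -> W}, (forall z : W, `|U z| = `|z|) & U x = y.

Definition segment_closed S :=
  forall x y (s : R), S x -> S y -> 0 <= s <= 1 -> S ((1 - s) *: x + s *: y).

(** If [y] and [z] lie in a convex set far from [x] and [s >= 0], this displays the left side as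
    [1 + s] times the displacement from [x] to a point of that set, hence as a long vector. *)
Lemma affine_shiftE x y z (s : R) : 0 < 1 + s -> (y - x) + s *: (z - x) =
  (1 + s) *: ((1 - s / (1 + s)) *: y + (s / (1 + s)) *: z - x).
Proof.
move=> s1; rewrite [RHS]scalerBr [in RHS]scalerDr !scalerA mulrBr mulr1 mulrCA.
rewrite divff ?gt_eqF// mulr1 addrK scale1r scalerDl scale1r opprD.
by rewrite scalerBr addrACA.
Qed.

(* Take [q] the least [r] for which some [S] admits a centre [x] that every
   smaller member approaches within [r].  Pushing [x] towards a point [c] of a
   member at distance about [q] from [x] would, by smoothness, decrease [q]. *)
Lemma uniformly_smooth_unavoidable_point FF (r0 : R) :
  uniformly_smooth V -> 0 < r0 ->
  (forall S, FF S -> segment_closed S) ->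
  (exists2 S, FF S & exists M : R, S `<=` [set z | `|z| < M]) ->
  (forall S, FF S -> S !=set0) ->
  exists2 S, FF S & exists x, forall S', FF S' -> S' `<=` S ->
    exists2 y, S' y & `|y - x| < r0.
Proof.
move=> smV r00 cF [S0 FS0 [M S0M]] FF0; apply: contrapT => noS.
pose near_all r x S := forall S', FF S' ->
  S' `<=` S -> exists2 y, S' y & `|y - x| < r.
pose A := [set r | exists S x, FF S /\ near_all r x S].
have A0 : A M.
  exists S0, 0; split => // S' FS' S'S0; have [y yS'] := FF0 _ FS'.
  by exists y => //; rewrite subr0; exact/S0M/S'S0.
have lbA : lbound A r0.
  move=> r [S [x [FS nr]]]; rewrite leNgt; apply/negP => rr0; apply: noS.
  exists S => //; exists x => S' FS' S'S; have [y yS' yr] := nr _ FS' S'S.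
  by exists y => //; exact: lt_trans rr0.
pose q := inf A.
have qr0 : r0 <= q by apply: lb_le_inf => //; exists M.
have q0 : 0 < q by exact: lt_le_trans qr0.
have infA : has_inf A by split; [exists M|exists r0].
have [t t0 smt] := smV (8^-1) ltac:(lra).
pose s := t / 2; pose tau := Num.min (s / 16) (16^-1).
have s0 : 0 < s by rewrite /s; lra.
have tau0 : 0 < tau by rewrite /tau lt_min; apply/andP; split; lra.
have tau1 : tau <= 16^-1 by rewrite /tau ge_min lexx orbT.
have taus : tau <= s / 16 by rewrite /tau ge_min lexx.
have [r [S [x [FS nr]]] rq] : exists2 r, A r & r < q * (1 + tau).
  by apply: inf_lt; [exists M|rewrite ltr_pMr; lra].
(* Since [q (1 - tau)] is below the infimum, some member [S1] inside [S] stays at least that far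
   from [x]. *)
have : ~ near_all (q * (1 - tau)) x S.
  move=> nr'; have : q <= q * (1 - tau)
    by apply: ge_inf; [exact: infA.2|exists S, x].
  by rewrite ler_pMr//; lra.
move=> /existsNP[S1 /not_implyP[FS1 /not_implyP[S1S far]]].
have {}far y : S1 y -> q * (1 - tau) <= `|y - x|.
  by move=> S1y; rewrite leNgt; apply/negP => yx; apply: far; exists y.
have [c S1c cx] := nr _ FS1 S1S.
(* The contradiction: centred at [x + s (c - x)], the set [S1] admits a radius below [q]. *)
have : q <= q * (1 - s / 8).
  apply: ge_inf; first exact: infA.2.
  exists S1, (x + s *: (c - x)); split => // S2 FS2 S21.
  have [y S2y yx] := nr _ FS2 (subset_trans S21 S1S).
  exists y => //.
  pose u := y - x; pose v := c - x.
  have S1y := S21 _ S2y.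
  have fy := far _ S1y; have fc := far _ S1c; rewrite -/u -/v in fy fc cx yx *.
  have uv : u - s *: v = y - (x + s *: v) by rewrite /u opprD addrA.
  rewrite -uv.
  (* Both [|u|] and [|v|] are close to [q]; the factor [2^-1], matched by [t = 2 s], secures the
     size condition of smoothness. *)
  have sv : s *: v = t *: (2^-1 *: v) by rewrite scalerA.
  have := smt u (2^-1 *: v); rewrite -sv normrZ ger0_norm ?invr_ge0//.
  have -> : 2^-1 * `|v| <= `|u| by nra.
  move=> /(_ isT).
  (* Convexity of [S1] makes [u + s v] long; smoothness then forces [u - s v] to be short. *)
  have : q * (1 - tau) * (1 + s) <= `|u + s *: v|.
    have s1 : 0 < 1 + s by lra.
    rewrite /u /v affine_shiftE//.
    rewrite normrZ gtr0_norm// mulrC ler_pM2l//; apply: far.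
    apply: cF => //; apply/andP; split; first by rewrite divr_ge0// ltW.
    by rewrite ler_pdivrMr//; lra.
  have : t = 2 * s by rewrite /s; lra.
  move=> ->; move: fy fc cx yx rq; rewrite -/u -/v => fy fc cx yx rq far_uv.
  have uq : `|u| < q * (1 + tau) by lra.
  have tq : tau * q <= s / 16 * q by rewrite ler_wpM2r// ltW.
  have tsq : tau * (s * q) <= 16^-1 * (s * q) by rewrite ler_wpM2r// ltW// mulr_gt0.
  have su : s * `|u| <= s * (q * (1 + tau)) by rewrite ler_wpM2l// ltW.
  have : 0 < s * q by rewrite mulr_gt0.
  nra.
by rewrite ler_pMr//; lra.
Qed.

End UniformSmoothness.

(** * Slices of the unit ball and uniform convexity *)

Section Slices.
Context {R : realType} {V : normedModType R}.
Implicit Types (x y z : V) (f h : V -> R).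

Lemma norming_functional x : exists h : V -> R,
  [/\ scalar h, forall z, h z <= `|z| & h x = `|x|].
Proof.
apply: Hahn_Banach_sublinear; split=> [y z|a z a0]; first exact: ler_normD.
by rewrite normrZ ger0_norm.
Qed.

Definition slice f (a : R) : set V := [set z | `|z| <= 1 /\ a < f z].

(** The one-sided bound by [M] makes [f] continuous, since it applies to [- z] as well. *)
Definition slices : set (set V) := [set S | S !=set0 /\
  exists f a M, [/\ scalar f, forall z, f z <= M * `|z| & S = slice f a]].

Lemma slices_segment_closed S : slices S -> segment_closed S.
Proof.
move=> [_ [f [a [M [sf _ ->]]]]] x y s [x1 ax] [y1 ay] /andP[s0 s1].
split.
  rewrite (le_trans (ler_normD _ _))// !normrZ !ger0_norm//; last lra.
  have : 0 <= s * (1 - `|y|) by rewrite mulr_ge0// subr_ge0.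
  have : 0 <= (1 - s) * (1 - `|x|) by rewrite mulr_ge0// subr_ge0.
  lra.
rewrite addrC sf scalar_funZ// -subr_gt0.
have -> : s * f y + (1 - s) * f x - a = s * (f y - a) + (1 - s) * (f x - a).
  by ring.
have [->|s_neq1] := eqVneq s 1; first by lra.
rewrite ltr_wpDl ?mulr_ge0 ?mulr_gt0 ?subr_gt0//; last first.
  by rewrite lt_neqAle s_neq1.
by rewrite subr_ge0 ltW.
Qed.

(* The slice is cut by [f + t h], where [h] norms [x - d] for a point [x] of
   [S] at which [f] is almost maximal and [t] is small. *)
Lemma subslice_away (e : R) d S : 0 < e ->
  (forall S', slices S' -> exists2 x, S' x & e < `|x - d|) ->
  slices S ->
  exists2 S', slices S' & S' `<=` S /\ forall y, S' y -> e / 2 <= `|y - d|.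
Proof.
move=> e0 wide [[z Sz] [f [a [M [sf fM SE]]]]].
move: Sz; rewrite {}SE => -[z1 az].
pose E := [set f x | x in [set x | `|x| <= 1]].
have M0 x : `|x| <= 1 -> f x <= `|M|.
  move=> x1; rewrite (le_trans (fM x))// (le_trans (ler_norm _))// normrM normr_id.
  by rewrite ler_piMr.
have supE : has_sup E.
  split; first by exists (f z), z.
  by exists `|M| => _ [x /= x1 <-]; exact: M0.
have az' : a < sup E.
  by rewrite (lt_le_trans az)//; apply: ub_le_sup; [exact: supE.2|exists z].
pose g := sup E - a; have g0 : 0 < g by rewrite /g subr_gt0.
(* [t (2 + e) = g / 4] and [del <= g / 2] keep the new slice above the level [a], while
   [del <= t e / 4] leaves at most [e / 2] for [h x - h y]. *)
pose t := g / (4 * (2 + e)); have t0 : 0 < t by rewrite divr_gt0//; lra.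
have tg : t * (2 + e) = g / 4 by rewrite /t; field; lra.
pose del := Num.min (t * e / 4) (g / 2).
have te0 : 0 < t * e by rewrite mulr_gt0.
have del0 : 0 < del by rewrite /del lt_min; apply/andP; split; lra.
have del1 : del <= t * e / 4 by rewrite /del ge_min lexx.
have del2 : del <= g / 2 by rewrite /del ge_min lexx orbT.
have [|x [x1 fx] xd] := wide (slice f (sup E - del)).
  split; last by exists f, (sup E - del), M.
  have [_ [u /= u1 <-] uE] := sup_adherent del0 supE.
  by exists u.
have [h [sh hle hx]] := norming_functional (x - d).
have hN y : - `|y| <= h y.
  by have := hle (- y); rewrite scalar_funN// normrN; lra.
exists (slice (fun y => f y + t * h y) (f x + t * h x - t * e / 4)).
  split; first by exists x; split => //; lra.
  exists (fun y => f y + t * h y), (f x + t * h x - t * e / 4), (M + t); split => //.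
    by move=> b y y'; rewrite sf sh; ring.
  by move=> y; rewrite mulrDl lerD// ler_pM2l.
split=> y [y1 fy].
  split=> //; have : h x - h y >= - 2.
    by have := hN x; have := hle y; lra.
  rewrite -(ler_pM2l t0) => hxy.
  rewrite /g in del2 tg; lra.
have fyE : f y <= sup E by apply: ub_le_sup; [exact: supE.2|exists y].
have : t * (h x - h y) <= t * (e / 2) by lra.
rewrite ler_pM2l// => hxy.
have := hle (y - d); rewrite scalar_funB//.
by move: hx; rewrite scalar_funB//; lra.
Qed.

(** If convexity fails at one unit vector, transitivity makes it fail at all, so every slice
    contains two points at least [e / 2] apart and reaches beyond [e / 5] from any given point. By
    [subslice_away] no point is then unavoidable for slices, against
    [uniformly_smooth_unavoidable_point]. *)
Lemma uniformly_smooth_transitive_convex :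
  uniformly_smooth V -> transitive_sphere V -> uniformly_convex V.
Proof.
move=> smV trV e e0; apply: contrapT => nc.
have {nc} nc d : 0 < d -> exists x y : V,
    [/\ `|x| = 1, `|x + y| <= 1 + d, `|x - y| <= 1 + d & e <= `|y|].
  move=> d0; apply: contrapT => nxy; apply: nc; exists d => // x y x1 xDy xBy.
  by rewrite ltNge; apply/negP => ey; apply: nxy; exists x, y.
have [u u1] : exists u : V, `|u| = 1.
  by have [u [_ [u1 _ _ _]]] := nc _ ltr01; exists u.
have {}nc d x : 0 < d -> `|x| = 1 -> exists y : V,
    [/\ `|x + y| <= 1 + d, `|x - y| <= 1 + d & e <= `|y|].
  move=> d0 x1; have [x' [y [x'1 xDy xBy ey]]] := nc _ d0.
  have [U isoU Ux] := trV _ _ x'1 x1.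
  by exists (U y); rewrite -Ux -linearD -linearB !isoU.
have wide d S : slices S -> exists2 x, S x & e / 5 < `|x - d|.
  move=> [[z Sz] [f [a [M [sf fM SE]]]]]; rewrite {}SE in Sz *.
  have [x x1 ax] : exists2 x, `|x| = 1 & a < f x.
    have [z1 az] := Sz.
    have [z0|z0] := eqVneq z 0.
      rewrite z0 scalar_fun0// in az.
      have [fu|fu] := leP 0 (f u); [exists u|exists (- u)] => //.
      - exact: lt_le_trans fu.
      - by rewrite normrN.
      - by rewrite scalar_funN//; lra.
    have nz : 0 < `|z| by rewrite normr_gt0.
    have wz : `| `|z|^-1 *: z| = 1.
      by rewrite normrZ gtr0_norm ?invr_gt0// mulVf ?gt_eqF.
    have [fz|fz] := leP 0 (f z).
      exists (`|z|^-1 *: z) => //; rewrite scalar_funZ// mulrC ltr_pdivlMr//.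
      have [a0|a0] := leP 0 a; last by nra.
      by rewrite (le_lt_trans _ az)// ler_piMr.
    exists (- (`|z|^-1 *: z)); rewrite ?normrN// scalar_funN// scalar_funZ// -mulrN.
    rewrite (lt_trans (lt_trans az fz))// mulr_gt0 ?invr_gt0//; lra.
  have fx : f x <= M by rewrite (le_trans (fM x))// x1 mulr1.
  (* [a (1 + del) < f x] holds whatever the sign of [a], so division by [1 + del] brings points of
     the enlarged ball into the slice; [del <= 1] preserves at least half of their distances. *)
  pose del := Num.min 1 ((f x - a) / (2 * (1 + `|a|))).
  have na : 0 < 2 * (1 + `|a|) by have := normr_ge0 a; lra.
  have del0 : 0 < del by rewrite lt_min ltr01 divr_gt0// subr_gt0.
  have del1 : del <= 1 by rewrite ge_min lexx.
  have adel : a * (1 + del) < f x.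
    have : del * (2 * (1 + `|a|)) <= f x - a.
      by rewrite -ler_pdivlMr// ge_min lexx orbT.
    have : a * del <= `|a| * del by rewrite ler_pM2r// ler_norm.
    have : 0 <= `|a| * del by rewrite mulr_ge0// ltW.
    lra.
  have [y [xDy xBy ey]] := nc _ x del0 x1.
  have d1 : 0 < 1 + del by lra.
  pose k := (1 + del)^-1; have k0 : 0 < k by rewrite invr_gt0.
  have kle : 2^-1 <= k by rewrite lef_pV2 ?posrE//; lra.
  have inS w : `|w| <= 1 + del -> a * (1 + del) < f w -> slice f a (k *: w).
    move=> w1 aw; split.
      by rewrite normrZ gtr0_norm// mulrC ler_pdivrMr ?mul1r.
    by rewrite scalar_funZ// mulrC ltr_pdivlMr.
  have Sx : slice f a (k *: x) by apply: inS => //; rewrite x1; lra.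
  (* Of the two ends [x + y] and [x - y], take one at which [f] is at least [f x]. *)
  have [w [w1 aw wx]] : exists w,
      [/\ `|w| <= 1 + del, a * (1 + del) < f w & `|w - x| = `|y|].
    have [fy|fy] := leP 0 (f y); [exists (x + y)|exists (x - y)]; split => //.
    - by rewrite -[y]scale1r scalarDZ//; lra.
    - by rewrite addrC addKr.
    - by rewrite scalar_funB//; lra.
    - by rewrite addrC addKr normrN.
  have Sw := inS _ w1 aw.
  have [xd|xd] := ltP (e / 5) (`|k *: x - d|); first by exists (k *: x).
  exists (k *: w) => //; rewrite ltNge; apply/negP => wd.
  have : `|k *: w - k *: x| <= `|k *: w - d| + `|k *: x - d|.
    by rewrite [`|k *: x - d|]distrC -[X in `|X| <= _](subrKA d) ler_normD.
  rewrite -scalerBr normrZ gtr0_norm// wx => kx.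
  have : 2^-1 * e <= k * `|y| by rewrite ler_pM// ltW.
  lra.
have e5 : 0 < e / 5 by lra.
have e10 : 0 < e / 5 / 2 by lra.
have [| |S FS [d nS]] :=
  uniformly_smooth_unavoidable_point smV e10 slices_segment_closed.
- exists (slice (fun=> 0) (- 1)).
    split; first by exists 0; split; rewrite ?normr0//; lra.
    exists (fun=> 0), (- 1), 0; split => [a x y|z|]; rewrite ?mulr0 ?addr0 ?mul0r //.
  by exists 2 => z [z1 _] /=; lra.
- by move=> S [].
have [S' FS' [S'S far]] := subslice_away e5 (wide d) FS.
have [y S'y] := nS _ FS' S'S.
by rewrite ltNge far.
Qed.

(** With [k = 1 / |x + y|], the vectors [2 k x] and [2 k y] are the unit vector [k (x + y)] plus and
    minus [k (x - y)]. *)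
Lemma uniformly_convex_midpoint : uniformly_convex V ->
  forall e : R, 0 < e -> exists2 d : R, 0 < d & forall x y,
    `|x| <= 1 -> `|y| <= 1 -> 2 - d <= `|x + y| -> `|x - y| < e.
Proof.
move=> cV e e0; have [d d0 dP] := cV (e / 2) ltac:(lra).
pose d' := Num.min d 1.
have d'0 : 0 < d' by rewrite lt_min d0 ltr01.
have d'1 : d' <= 1 by rewrite ge_min lexx orbT.
have d'd : d' <= d by rewrite ge_min lexx.
exists d' => // x y x1 y1 xyd.
pose r := `|x + y| / 2.
have r_lo : 1 - d' / 2 <= r by rewrite /r; lra.
have r_hi : r <= 1 by rewrite /r; have := ler_normD x y; lra.
have r0 : 0 < r by lra.
pose k := (2 * r)^-1; have k0 : 0 < k by rewrite invr_gt0; lra.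
have kr : k * (2 * r) = 1 by rewrite mulVf//; lra.
have near z : `|z| <= 1 -> `|(2 * k) *: z| <= 1 + d.
  move=> z1; rewrite normrZ gtr0_norm ?mulr_gt0//.
  have : 2 * k * `|z| <= 2 * k by rewrite ler_piMr//; lra.
  have : 2 * k <= 1 + d'.
    have -> : 2 * k = r^-1 by rewrite /k; field; lra.
    rewrite -(ler_pM2r r0) mulVf ?gt_eqF//.
    have : (1 + d') * (1 - d' / 2) <= (1 + d') * r by rewrite ler_pM2l//; lra.
    have : d' * d' <= d' by rewrite ger_pMr.
    lra.
  lra.
have kxy : `|k *: (x - y)| < e / 2.
  apply: dP (k *: (x + y)) _ _ _ _.
  - by rewrite normrZ gtr0_norm// -kr /r; congr (_ * _); field.
  - rewrite -scalerDr addrACA subrr addr0 -mulr2n -scaler_nat scalerA mulrC.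
    exact: near.
  - rewrite -scalerBr opprB [x + y]addrC addrACA subrr addr0 -mulr2n.
    by rewrite -scaler_nat scalerA mulrC near.
move: kxy; rewrite normrZ gtr0_norm// -(ltr_pM2r (_ : 0 < 2 * r)); last by lra.
rewrite mulrAC kr mul1r.
have : e * r <= e by rewrite ler_piMr// ltW.
lra.
Qed.

End Slices.

(** * Micro-transitivity *)

Section MicroTransitivity.
Context {R : realType}.

Definition real_micro_transitive (V : normedModType R) :=
  forall e : R, 0 < e -> exists2 th : R, 0 < th &
    forall x y : V, `|x| = 1 -> `|y| = 1 -> `|x - y| < th ->
      exists2 U : {linear V -> V}, (forall z : V, `|U z| = `|z|) &
        U x = y /\ forall z : V, `|U z - z| <= e * `|z|.

Context (V : normedModType R) (microV : real_micro_transitive V).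
Implicit Types x y z : V.

(* The slopes of a 1-Lipschitz function on a fine grid lie in [[-t, t]], so two
   consecutive ones are close to each other. *)
Lemma small_second_difference (f : nat -> R) (t c : R) (n : nat) :
  (forall i, `|f i.+1 - f i| <= t) -> 2 * t < c *+ n ->
  exists2 i, (i < n)%N & f i.+2 + f i - 2 * f i.+1 <= c.
Proof.
move=> flip tn; apply: contrapT => nf.
have {}nf i : (i < n)%N -> c < f i.+2 + f i - 2 * f i.+1.
  by move=> ilt; rewrite ltNge; apply/negP => fc; apply: nf; exists i.
have : forall m, (m <= n)%N -> f 1%N - f 0%N + c *+ m <= f m.+1 - f m.
  elim=> [_|m IH mn]; first by rewrite mulr0n addr0.
  by have := nf _ mn; have := IH (ltnW mn); rewrite mulrSr; lra.
move=> /(_ n (leqnn _)).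
have := flip n; have := flip 0%N; rewrite !ler_norml => /andP[? ?] /andP[? ?].
lra.
Qed.

Lemma micro_transitive_uniformly_smooth : uniformly_smooth V.
Proof.
move=> w w0; have [th th0 thP] := microV (e := w / 8) ltac:(lra).
(* With [K > 8 / w], increments of [w t / 4] over [K] steps exceed the total range [2 t] of the
   slopes. *)
pose K := (Num.truncn (8 / w)).+1.
have Kw : 8 / w < K%:R by rewrite /K truncnS_gt.
pose s0 := Num.min 2^-1 (th / 4).
have s00 : 0 < s0 by rewrite lt_min; apply/andP; split; lra.
have s01 : s0 <= 2^-1 by rewrite ge_min lexx.
have s0th : s0 <= th / 4 by rewrite ge_min lexx orbT.
(* This mesh keeps the grid points within [s0] of [x], hence their normalizations within
   [2 s0 < th]. *)
pose t := s0 / K.+1%:R.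
have t0 : 0 < t by rewrite divr_gt0.
have unit_case x y : `|x| = 1 -> `|y| <= 1 ->
    `|x + (t / 2) *: y| + `|x - (t / 2) *: y| <= 2 + w * (t / 2).
  move=> x1 y1; pose f i := `|x + (t *+ i) *: y|.
  have ty : `|t *: y| <= t by rewrite normrZ gtr0_norm// ler_piMr// ltW.
  have [i|| i iK fi] := @small_second_difference f t (w / 4 * t) K.
  - rewrite /f (le_trans (ler_dist_dist _ _))// mulrSr scalerDl.
    by rewrite opprD addrACA subrr add0r addrAC subrr add0r.
  - rewrite -mulr_natr; have : 8 < K%:R * w by rewrite -ltr_pdivrMr.
    by rewrite -(ltr_pM2r t0); lra.
  pose p := t *+ i.+1; pose x' := x + p *: y.
  have p0 : 0 < p by rewrite mulrn_wgt0.
  have ps0 : p <= s0.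
    rewrite /p /t -mulr_natr mulrAC ler_pdivrMr// ler_pM2l// ler_nat.
    exact: leqW.
  have py : `|p *: y| <= s0.
    by rewrite normrZ gtr0_norm// (le_trans _ ps0)// ler_piMr// ltW.
  pose r := `|x'|.
  have rx : `|r - 1| <= s0.
    rewrite -x1 (le_trans (ler_dist_dist _ _))// /x' addrAC subrr add0r//.
  have [r_lo r_hi] : 1 - s0 <= r /\ r <= 1 + s0.
    by move: rx; rewrite ler_norml => /andP[? ?]; split; lra.
  have r0 : 0 < r by lra.
  have r'1 : `|r^-1 *: x'| = 1.
    by rewrite normrZ gtr0_norm ?invr_gt0// mulVf// gt_eqF.
  (* [U] sends the normalized grid point to [x] and moves [y] by at most [w / 8], so the small
     second difference is transported to [r x], still essentially in the direction [y]. *)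
  have [|U isoU [Ux UI]] := thP _ _ r'1 x1.
    have -> : r^-1 *: x' - x = (r^-1 *: x' - x') + p *: y.
      by rewrite /x' opprD -!addrA [- (p *: y) + _]addNr addr0.
    have : `|r^-1 *: x' - x'| <= s0.
      rewrite -{2}[x']scale1r -scalerBl normrZ -/r.
      rewrite -[r in _ * r](gtr0_norm r0) -normrM mulrBl.
      by rewrite mulVf ?gt_eqF// mul1r distrC.
    by have := ler_normD (r^-1 *: x' - x') (p *: y); lra.
  have Ux' : U x' = r *: x.
    by rewrite -Ux linearZ scalerA divff ?scale1r// gt_eqF.
  have UyB : `|t *: (U y - y)| <= w / 8 * t.
    rewrite normrZ gtr0_norm// mulrC ler_pM2r// (le_trans (UI _))//.
    by rewrite ler_piMr//; lra.
  have rxy : `|r *: x + t *: y| + `|r *: x - t *: y| <= 2 * r + w / 2 * t.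
    have f2 : f i.+2 = `|r *: x + t *: U y|.
      rewrite -Ux' -linearZ -linearD isoU /f mulrSr scalerDl addrA.
      by rewrite /x' /p.
    have f0 : f i = `|r *: x - t *: U y|.
      by rewrite -Ux' -linearZ -linearB isoU /f /x' /p mulrSr scalerDl addrA addrK.
    have f1 : f i.+1 = r by [].
    move: fi; rewrite f2 f0 f1.
    have -> : r *: x + t *: y = (r *: x + t *: U y) - t *: (U y - y).
      by rewrite scalerBr opprB addrACA subrr addr0.
    have -> : r *: x - t *: y = (r *: x - t *: U y) + t *: (U y - y).
      by rewrite scalerBr addrA subrK.
    have := ler_normB (r *: x + t *: U y) (t *: (U y - y)).
    have := ler_normD (r *: x - t *: U y) (t *: (U y - y)).
    lra.
  (* This passes from [r x] back to [x]; halving the step keeps the weight [1 - r / 2]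
     nonnegative. *)
  have E (b : R) : x + (b * (t / 2)) *: y =
      (1 - r / 2) *: x + 2^-1 *: (r *: x + (b * t) *: y).
    rewrite [in RHS]scalerDr !scalerA addrA -scalerDl -{1}[x]scale1r.
    by congr (_ *: _ + _ *: _); field.
  have comb (b : R) : `|x + (b * (t / 2)) *: y| <=
      (1 - r / 2) + 2^-1 * `|r *: x + (b * t) *: y|.
    rewrite E (le_trans (ler_normD _ _))// !normrZ x1 mulr1.
    by rewrite !ger0_norm//; lra.
  have := comb 1; have := comb (- 1); rewrite !mul1r !mulN1r !scaleNr.
  by have := mulr_gt0 w0 t0; move: rxy; lra.
exists (t / 2) => [|x y yx]; first by lra.
have [x0|x0] := eqVneq x 0.
  move: yx; rewrite x0 normr0 normr_le0 => /eqP ->.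
  by rewrite scaler0 subr0 addr0 normr0 !mulr0 addr0.
have nx : 0 < `|x| by rewrite normr_gt0.
have := unit_case (`|x|^-1 *: x) (`|x|^-1 *: y).
rewrite !normrZ !gtr0_norm ?invr_gt0// mulVf ?gt_eqF// => /(_ erefl).
rewrite mulrC ler_pdivrMr// mul1r => /(_ yx).
rewrite !scalerA mulrC -!scalerA -scalerBr -scalerDr !normrZ gtr0_norm ?invr_gt0//.
by rewrite -mulrDr mulrC ler_pdivrMr// mulrC.
Qed.

Lemma normalize_dist x y : x != 0 -> y != 0 ->
  `| `|x|^-1 *: x - `|y|^-1 *: y| <= 2 * `|x - y| / `|x|.
Proof.
move=> x0 y0; have nx : 0 < `|x| by rewrite normr_gt0.
have ny : 0 < `|y| by rewrite normr_gt0.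
have -> : `|x|^-1 *: x - `|y|^-1 *: y =
    `|x|^-1 *: (x - y) + (`|x|^-1 - `|y|^-1) *: y.
  by rewrite scalerBr scalerBl addrA subrK.
rewrite (le_trans (ler_normD _ _))// !normrZ gtr0_norm ?invr_gt0//.
have -> : `| `|x|^-1 - `|y|^-1| * `|y| = `| `|x| - `|y| | / `|x|.
  have -> : `|x|^-1 - `|y|^-1 = (`|y| - `|x|) / (`|x| * `|y|).
    by field; rewrite !gt_eqF.
  by rewrite normrM normfV normrM !normr_id distrC; field; rewrite !gt_eqF.
have : `| `|x| - `|y| | / `|x| <= `|x - y| / `|x|.
  by rewrite ler_pM2r ?invr_gt0// ler_dist_dist.
lra.
Qed.

(** Unequal weights bound the norm below by [2 |1/2 - s|] for [s] in [[0, 1]], and closeness to the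
    midpoint bounds it below by [|x + y| / 2 - 2 |1/2 - s|]; the two add up. *)
Lemma segment_away_from_0 x y (s : R) : `|x| = 1 -> `|y| = 1 ->
  `|x + y| / 4 <= `|(1 - s) *: x + s *: y|.
Proof.
move=> x1 y1; set p := _ + s *: y.
have : `|1 - s| - `|s| <= `|p|.
  have -> : p = (1 - s) *: x - - (s *: y) by rewrite opprK.
  by rewrite (le_trans _ (lerB_dist _ _))// normrN !normrZ x1 y1 !mulr1.
have : `|s| - `|1 - s| <= `|p|.
  have -> : p = s *: y - - ((1 - s) *: x) by rewrite opprK addrC.
  by rewrite (le_trans _ (lerB_dist _ _))// normrN !normrZ x1 y1 !mulr1.
have : `|x + y| / 2 - 2 * `|2^-1 - s| <= `|p|.
  have -> : p = 2^-1 *: (x + y) - (2^-1 - s) *: (y - x).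
    rewrite scalerDr scalerBr opprB addrACA -scalerBl -scalerDl.
    by congr (_ *: _ + _ *: _); field.
  rewrite (le_trans _ (lerB_dist _ _))// !normrZ gtr0_norm ?invr_gt0//.
  have : `|y - x| <= 2 by rewrite (le_trans (ler_normB _ _))// x1 y1; lra.
  move=> /(ler_wpM2l (normr_ge0 (2^-1 - s))); lra.
have : `|x + y| <= 2 by rewrite (le_trans (ler_normD _ _))// x1 y1; lra.
have [s2|s2] := leP s 2^-1.
  rewrite [`|2^-1 - s|]ger0_norm ?[`|1 - s|]ger0_norm; try lra.
  have [s0|s0] := leP 0 s;
    [rewrite [`|s|]ger0_norm//|rewrite [`|s|]ltr0_norm//]; lra.
rewrite [`|2^-1 - s|]ltr0_norm ?[`|s|]ger0_norm; try lra.
have [s1|s1] := leP s 1;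
  [rewrite [`|1 - s|]ger0_norm|rewrite [`|1 - s|]ltr0_norm]; lra.
Qed.

(** The segment from [x] to [y] avoids 0, so it can be normalized and cut into steps shorter than
    [th]; the isometries of the steps are composed. *)
Lemma micro_transitive_isometry x y : `|x| = 1 -> `|y| = 1 -> x + y != 0 ->
  exists2 U : {linear V -> V}, (forall z : V, `|U z| = `|z|) & U x = y.
Proof.
move=> x1 y1 xy0; have [th th0 thP] := microV ltr01.
pose c := `|x + y| / 4; have c0 : 0 < c by rewrite divr_gt0// normr_gt0.
(* By [normalize_dist] each step has length at most [4 / (n c)]. *)
pose n := (Num.truncn (4 / (c * th))).+1.
have nth' : 4 / (c * th) < n%:R by rewrite truncnS_gt.
pose p (k : nat) := (1 - k%:R / n%:R) *: x + (k%:R / n%:R) *: y.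
have pc k : c <= `|p k| by exact: segment_away_from_0.
have p0 k : p k != 0 by rewrite -normr_gt0 (lt_le_trans c0).
pose u k := `|p k|^-1 *: p k.
have u1 k : `|u k| = 1.
  by rewrite normrZ gtr0_norm ?invr_gt0 ?normr_gt0// mulVf// normr_eq0.
have step k : `|u k - u k.+1| < th.
  rewrite (le_lt_trans (normalize_dist (p0 k) (p0 k.+1)))//.
  rewrite ltr_pdivrMr ?normr_gt0//.
  have -> : p k - p k.+1 = n%:R^-1 *: (x - y).
    rewrite /p opprD addrACA -scalerBl -scalerBl -(natr1 k) scalerBr.
    rewrite -[X in _ = _ + X]scaleNr.
    by congr (_ *: _ + _ *: _); field; rewrite pnatr_eq0.
  rewrite normrZ gtr0_norm ?invr_gt0//.
  have : `|x - y| <= 2 by rewrite (le_trans (ler_normB _ _))// x1 y1; lra.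
  move=> xy2; have n0 : 0 < n%:R^-1 :> R by rewrite invr_gt0.
  have : n%:R^-1 * `|x - y| <= n%:R^-1 * 2 by rewrite ler_pM2l.
  have : 4 * n%:R^-1 < c * th.
    by rewrite ltr_pdivrMr// mulrC -ltr_pdivrMr// mulr_gt0.
  have : c * th <= `|p k| * th by rewrite ler_pM2r.
  lra.
have : forall k, exists2 U : {linear V -> V},
    (forall z : V, `|U z| = `|z|) & U x = u k.
  elim=> [|k [U isoU Ux]].
    exists idfun => //=.
    by rewrite /u /p mul0r subr0 scale1r scale0r addr0 x1 invr1 scale1r.
  have [W isoW [Wu _]] := thP _ _ (u1 k) (u1 k.+1) (step k).
  by exists (W \o U) => [z|]/=; rewrite ?isoW ?isoU// Ux.
move=> /(_ n); rewrite /u /p divff ?pnatr_eq0// subrr scale0r add0r scale1r.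
by rewrite y1 invr1 scale1r.
Qed.

End MicroTransitivity.

(** * Complex normed spaces *)

Lemma complex_phase (R : realType) (c : R[i]) :
  exists2 l : R[i], `|l| = 1 & l * c = `|c|.
Proof.
have [->|c0] := eqVneq c 0; first by exists 1; rewrite ?normr1// mulr0 normr0.
exists (`|c| / c); last by rewrite divfK.
by rewrite normrM normfV normr_id divff// normr_eq0.
Qed.

Lemma Re_normE (R : realType) (c : R[i]) : (complex.Re `|c|)%:C = `|c|.
Proof. by rewrite normc_def. Qed.

Lemma Re_norm_ge0 (R : realType) (c : R[i]) : 0 <= complex.Re `|c|.
Proof. by rewrite normc_def sqrtr_ge0. Qed.

Lemma ler_Re_norm (R : realType) (c : R[i]) : complex.Re c <= complex.Re `|c|.
Proof.
rewrite normc_def/= (le_trans (ler_norm _))// -sqrtr_sqr.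
by apply: ler_wsqrtr; rewrite lerDl sqr_ge0.
Qed.

Section RealNormExtra.
Context {R : realType} {V : normedModType R[i]}.
Implicit Types x y : V.

Lemma rnormN x : rnorm (- x) = rnorm x.
Proof. by rewrite /rnorm normrN. Qed.

Lemma rnorm_distC x y : rnorm (x - y) = rnorm (y - x).
Proof. by rewrite -rnormN opprB. Qed.

Lemma ler_rnormB x y : rnorm (x - y) <= rnorm x + rnorm y.
Proof. by rewrite -[rnorm y]rnormN ler_rnormD. Qed.

Lemma rnormZ_real (a : R) x : rnorm (a%:C *: x) = `|a| * rnorm x.
Proof. by rewrite rnormZ normc_def/= expr0n addr0 sqrtr_sqr. Qed.

Lemma rnormZ_nneg (a : R) x : 0 <= a -> rnorm (a%:C *: x) = a * rnorm x.
Proof. by move=> a0; rewrite rnormZ_real ger0_norm. Qed.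

Lemma rnormZ_unit (l : R[i]) x : `|l| = 1 -> rnorm (l *: x) = rnorm x.
Proof. by move=> l1; rewrite rnormZ l1 mul1r. Qed.

End RealNormExtra.

(** * The underlying real normed space *)

Section Realified.
Context {R : realType}.

(** A separate name keeps the real scaling and norm apart from the complex ones. *)
Definition realified (X : normedModType R[i]) : Type := X.

Context (X : normedModType R[i]).
Local Notation XR := (realified X).

HB.instance Definition _ := GRing.Zmodule.copy XR X.

Definition real_scale (a : R) (x : XR) : XR := a%:C *: (x : X).

Let real_scaleA a b x : real_scale a (real_scale b x) = real_scale (a * b) x.
Proof. by rewrite /real_scale scalerA rmorphM. Qed.

Let real_scale1 : left_id 1 real_scale.
Proof. by move=> x; rewrite /real_scale scale1r. Qed.

Let real_scaleDr : right_distributive real_scale +%R.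
Proof. by move=> a x y; rewrite /real_scale scalerDr. Qed.

Let real_scaleDl x : {morph real_scale^~ x : a b / a + b}.
Proof. by move=> a b; rewrite /real_scale rmorphD scalerDl. Qed.

HB.instance Definition _ := GRing.Zmodule_isLmodule.Build R XR
  real_scaleA real_scale1 real_scaleDr real_scaleDl.

Let real_norm (x : XR) : R := rnorm (x : X).

Let real_normD x y : real_norm (x + y) <= real_norm x + real_norm y.
Proof. exact: ler_rnormD. Qed.

Let real_normZ (a : R) x : real_norm (a *: x) = `|a| * real_norm x.
Proof. exact: rnormZ_real. Qed.

Let real_norm_eq0 x : real_norm x = 0 -> x = 0.
Proof. exact: rnorm_eq0. Qed.

HB.instance Definition _ := Lmodule_isNormed.Build R XR
  real_normD real_normZ real_norm_eq0.

Lemma realified_normE (x : XR) : `|x| = rnorm (x : X).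
Proof. by []. Qed.

Lemma realified_scaleE (a : R) (x : XR) : a *: x = a%:C *: (x : X).
Proof. by []. Qed.

End Realified.

Section Transfer.
Context {R : realType} {X : normedModType R[i]}.

Section RealifiedMap.
Context (U : {linear X -> X}).

Definition realified_map (x : realified X) : realified X := U x.

Let realified_map_linear : linear realified_map.
Proof.
by move=> a x y; rewrite /realified_map !realified_scaleE linearD linearZ.
Qed.

HB.instance Definition _ := GRing.isLinear.Build R (realified X) (realified X)
  _ realified_map realified_map_linear.
End RealifiedMap.

(** Only scalability is assumed, so that the lemma applies directly to differences such as
    [S \- T]. *)
Lemma opnorm_leP (Z Y : normedModType R[i]) (T : Z -> Y) (M : R) :
  scalable T -> 0 <= M ->
  (opnorm T <= M%:E)%E <-> forall z, rnorm (T z) <= M * rnorm z.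
Proof.
move=> ZT M0; split=> [TM z|TM]; last first.
  apply: ge_ereal_sup => _ [z /= z1 <-]; rewrite lee_fin.
  by rewrite (le_trans (TM z))// ler_piMr.
have [z0|z0] := eqVneq (rnorm z) 0.
  rewrite z0 (rnorm_eq0 z0) mulr0 -(scale0r 0) ZT scale0r rnorm0//.
have nz : 0 < rnorm z by rewrite lt_neqAle eq_sym z0 rnorm_ge0.
have nzV : 0 < (rnorm z)^-1 by rewrite invr_gt0.
have : ((rnorm (T ((rnorm z)^-1%:C *: z)))%:E <= M%:E)%E.
  apply: le_trans TM; apply: ereal_sup_ubound; exists ((rnorm z)^-1%:C *: z) => //=.
  by rewrite rnormZ_nneg ?mulVf// ltW.
by rewrite lee_fin ZT rnormZ_nneg ?(ltW nzV)// ler_pdivrMl// mulrC.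
Qed.

Lemma micro_transitiveE : micro_transitive X ->
  forall e : R, 0 < e -> exists2 th : R, 0 < th &
    forall x y : X, rnorm x = 1 -> rnorm y = 1 -> rnorm (x - y) < th ->
      exists2 U : {linear X -> X}, (forall z, rnorm (U z) = rnorm z) &
        U x = y /\ forall z, rnorm (U z - z) <= e * rnorm z.
Proof.
move=> mX e e0; have [th [/andP[th0 _] thP]] := mX _ e0.
exists th => // x y x1 y1 xy; have [U [isoU Ux UI]] := thP _ _ x1 y1 xy.
exists U => //; split => // z.
have UIZ : scalable (U \- idfun)%R by move=> a v; rewrite /= linearZ -scalerBr.
exact: ((opnorm_leP UIZ (ltW e0)).1 (ltW UI)).
Qed.

Lemma realified_micro_transitive : micro_transitive X ->
  real_micro_transitive (realified X).
Proof.
move=> mX e e0; have [th th0 thP] := micro_transitiveE mX e0.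
exists th => // x y x1 y1 xy; have [U isoU UP] := thP _ _ x1 y1 xy.
by exists (realified_map U).
Qed.

(** For [y = - x] the real segment meets 0; the path goes through ['i x] instead. *)
Lemma realified_transitive_sphere : micro_transitive X ->
  transitive_sphere (realified X).
Proof.
move=> /realified_micro_transitive mX x y x1 y1.
have [xy0|] := eqVneq (x + y) 0; last exact: micro_transitive_isometry.
have yE : y = - x by apply/eqP; rewrite -addr_eq0 addrC xy0.
pose v : realified X := 'i *: (x : X).
have v1 : `|v| = 1.
  by rewrite realified_normE rnormZ_unit// normc_def /= expr0n add0r expr1n sqrtr1.
have x0 : (x : X) != 0.
  by apply/eqP => x0; move: x1; rewrite realified_normE x0 rnorm0; lra.
have xv0 : x + v != 0.
  suff : (1 + 'i) *: (x : X) != 0 by rewrite scalerDl scale1r.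
  by rewrite scaler_eq0 negb_or x0 andbT eq_complex /= addr0 oner_eq0.
have vy0 : v + y != 0.
  suff : ('i - 1) *: (x : X) != 0 by rewrite yE scalerBl scale1r.
  by rewrite scaler_eq0 negb_or x0 andbT eq_complex /= add0r oppr_eq0 oner_eq0.
have [U isoU Ux] := micro_transitive_isometry mX x1 v1 xv0.
have [W isoW Wv] := micro_transitive_isometry mX v1 y1 vy0.
by exists (W \o U) => [z|]/=; rewrite ?isoW ?isoU// Ux.
Qed.

Lemma micro_transitive_midpoint : micro_transitive X ->
  forall e : R, 0 < e -> exists2 d : R, 0 < d & forall x y : X,
    rnorm x <= 1 -> rnorm y <= 1 -> 2 - d <= rnorm (x + y) -> rnorm (x - y) < e.
Proof.
move=> mX; apply: (@uniformly_convex_midpoint _ (realified X)).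
apply: uniformly_smooth_transitive_convex.
  exact/micro_transitive_uniformly_smooth/realified_micro_transitive.
exact: realified_transitive_sphere.
Qed.

(** The complexification [h z - i h (i z)] of a real norming functional. Rotating [z] makes its
    value real, which gives the bound; at [x] the real part already equals the norm, so the
    imaginary part vanishes. *)
Lemma complex_norming_functional (x : X) : exists f : X -> R[i],
  [/\ scalar f, forall z, `|f z| <= `|z| & f x = `|x|].
Proof.
have [h [sh hle hx]] := norming_functional (x : realified X).
pose f (z : X) : R[i] := Complex (h z) (- h ('i *: z)).
have hZ (a : R) z : h (a%:C *: z) = a * h z.
  exact: (@scalar_funZ _ (realified X)).
have hD z w : h (z + w) = h z + h w by exact: (@scalar_funD _ (realified X)).
have hN z : h (- z) = - h z by exact: (@scalar_funN _ (realified X)).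
have sf : scalar f.
  move=> [a b] z w; rewrite /f.
  have -> : Complex a b = a%:C + b%:C * 'i.
    by apply/eqP; rewrite eq_complex /=; apply/andP; split; apply/eqP; ring.
  have hab v : h ((a%:C + b%:C * 'i) *: v) = a * h v + b * h ('i *: v).
    by rewrite scalerDl hD -scalerA !hZ.
  rewrite hD scalerDr hD scalerA [in 'i * _]mulrC -scalerA !hab.
  have -> : 'i *: ('i *: z) = - z by rewrite scalerA -expr2 sqr_i scaleN1r.
  rewrite hN; apply/eqP; rewrite eq_complex /=.
  by apply/andP; split; apply/eqP; ring.
have f_le z : `|f z| <= `|z|.
  have [l l1 flz] := complex_phase (f z).
  have {}flz : f (l *: z) = `|f z| by rewrite scalar_funZ.
  have : h (l *: z) <= rnorm z by rewrite -(rnormZ_unit z l1) hle.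
  rewrite -lecR rnormE; apply: le_trans.
  have -> : h (l *: z) = complex.Re (f (l *: z)) by [].
  by rewrite flz normc_def.
exists f; split => //.
have := f_le x; rewrite -rnormE.
have -> : f x = Complex (rnorm x) (- h ('i *: x)) by rewrite /f hx.
set b := - h _; rewrite normc_def lecR /= => sb.
have : rnorm x ^+ 2 + b ^+ 2 <= rnorm x ^+ 2.
  have ab : 0 <= rnorm x ^+ 2 + b ^+ 2 by rewrite addr_ge0 ?sqr_ge0.
  by rewrite -(sqr_sqrtr ab) ler_sqr ?nnegrE ?sqrtr_ge0 ?rnorm_ge0.
rewrite gerDl => b2; have /eqP : b ^+ 2 = 0 by apply/eqP; rewrite eq_le b2 sqr_ge0.
by rewrite sqrf_eq0 => /eqP ->.
Qed.

End Transfer.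

(** * Operators *)

Section Operators.
Context {R : realType}.
Implicit Types Z Y : normedModType R[i].

Lemma linear_ex Z Y (g : Z -> Y) : linear g ->
  exists T : {linear Z -> Y}, T =1 g.
Proof.
move=> lg; pose M := GRing.isLinear.Build R[i] Z Y _ g lg.
pose T : {linear Z -> Y} := HB.pack g M.
by exists T.
Qed.

Lemma operator_norm_ex Z Y (T : {linear Z -> Y}) (C : R) :
  (forall z, rnorm (T z) <= C * rnorm z) ->
  exists2 M : R, forall z, rnorm (T z) <= M * rnorm z &
    forall k, 0 < k -> exists2 z, rnorm z <= 1 & M - k < rnorm (T z).
Proof.
move=> TC; pose E := [set rnorm (T z) | z in [set z | rnorm z <= 1]].
have supE : has_sup E.
  split; first by exists (rnorm (T 0)), 0 => //=; rewrite rnorm0.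
  exists `|C| => _ [z /= z1 <-]; rewrite (le_trans (TC z))//.
  rewrite (le_trans (ler_wpM2r (rnorm_ge0 z) (ler_norm C)))//.
  by rewrite ler_piMr.
have M0 : 0 <= sup E.
  apply: ub_le_sup; first exact: supE.2.
  by exists 0 => /=; rewrite ?linear0 rnorm0.
have ZT : scalable T by move=> a v; rewrite linearZ.
exists (sup E) => [|k k0].
  apply/(opnorm_leP ZT M0)/ge_ereal_sup => _ [z /= z1 <-]; rewrite lee_fin.
  by apply: ub_le_sup; [exact: supE.2|exists z].
by have [_ [z /= z1 <-]] := sup_adherent k0 supE; exists z.
Qed.

Lemma op_sphere_rnorm_le Z Y (T : {linear Z -> Y}) : op_sphere T ->
  forall z, rnorm (T z) <= rnorm z.
Proof.
move=> [_ T1] z; have ZT : scalable T by move=> a v; rewrite linearZ.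
by have := (opnorm_leP ZT ler01).1 _ z; rewrite mul1r; apply; rewrite T1.
Qed.

Lemma op_sphere_attained Z Y (T : {linear Z -> Y}) z0 :
  (forall z, rnorm (T z) <= rnorm z) -> rnorm z0 = 1 -> rnorm (T z0) = 1 ->
  op_sphere T.
Proof.
move=> T_le z01 Tz01; split.
  apply/linear_bounded_continuous/linear_boundedP; near=> r => z.
  rewrite -!rnormE.
  have : ((rnorm (T z))%:C <= 1 * (rnorm z)%:C) by rewrite mul1r lecR.
  move=> /le_trans; apply; rewrite ler_wpM2r// ?ler0c ?rnorm_ge0//.
have ZT : scalable T by move=> a v; rewrite linearZ.
apply/eqP; rewrite eq_le; apply/andP; split.
  by apply/(opnorm_leP ZT ler01) => z; rewrite mul1r.
apply: ereal_sup_ubound; exists z0; rewrite /= ?z01// Tz01//.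
Unshelve. all: by end_near. Qed.

Lemma C_uniformly_convexE Y : C_uniformly_convex Y -> forall e : R, 0 < e ->
  exists2 d : R, 0 < d & forall x y : Y, rnorm x = 1 -> rnorm y = 1 ->
    exists2 l : R[i], `|l| = 1 & 1 + d < rnorm (x + (l * e%:C) *: y).
Proof.
move=> cY e e0; have := cY _ e0; set m := modulus_Cconvexity Y e => m0.
have [d d0 dm] : exists2 d : R, 0 < d & (d%:E < m)%E.
  (* The value [+oo] arises when the sphere of [Y] is empty; any [d] then serves. *)
  move: m0; case: m => [r| |]//; last by exists 1; rewrite ?ltry.
  by rewrite lte_fin => r0; exists (r / 2); rewrite ?lte_fin; lra.
exists d => // x y x1 y1.
set E := [set (rnorm (x + (l * e%:C) *: y))%:E |
  l in [set l : R[i] | `|l| = 1]].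
have : (m <= ereal_sup E - 1)%E.
  by apply: ereal_inf_lbound; exists (x, y).
move=> /(lt_le_trans dm); rewrite lteBrDr// -EFinD addrC.
by move=> /ereal_sup_gt[_ [l /= l1 <-]]; rewrite lte_fin; exists l.
Qed.

End Operators.

(** * Limits of geometrically convergent sequences of operators *)

Lemma exists_geometric_lt (R : realType) (C e : R) :
  0 < e -> exists k, C / 2 ^+ k < e.
Proof.
move=> e0; have lt2 m : m%:R < 2 ^+ m :> R by rewrite -natrX ltr_nat ltn_expl.
exists (Num.truncn (`|C| / e)).+1.
rewrite ltr_pdivrMr ?exprn_gt0// mulrC (le_lt_trans (ler_norm C))//.
by rewrite -ltr_pdivrMr// (lt_trans (truncnS_gt _)).
Qed.

Section GeometricLimit.
Context {R : realType}.
Context {Z : normedModType R[i]} {Y : completeNormedModType R[i]}.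

(** The subtracted term makes the bound telescope, so the induction on [m] closes. *)
Lemma geometric_cauchy_tail (u : nat -> Y) (C : R) :
  (forall k, rnorm (u k.+1 - u k) <= C / 2 ^+ k) ->
  forall k m, (k <= m)%N ->
    rnorm (u m - u k) <= 2 * C / 2 ^+ k - 2 * C / 2 ^+ m.
Proof.
move=> uC k; elim=> [|m IH].
  by rewrite leqn0 => /eqP ->; rewrite !subrr rnorm0.
rewrite leq_eqVlt => /predU1P[->|]; first by rewrite !subrr rnorm0.
rewrite ltnS => /IH {}IH; have := uC m.
have := ler_rnormD (u m.+1 - u m) (u m - u k).
rewrite subrKA exprS.
have -> : 2 * C / (2 * 2 ^+ m) = C / 2 ^+ m by field; rewrite expf_neq0.
have : 2 * C / 2 ^+ m = C / 2 ^+ m + C / 2 ^+ m by field; rewrite expf_neq0.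
by move: IH; lra.
Qed.

Lemma geometric_cauchy_cvg (u : nat -> Y) (C : R) :
  (forall k, rnorm (u k.+1 - u k) <= C / 2 ^+ k) ->
  exists l : Y, forall k, rnorm (l - u k) <= 2 * C / 2 ^+ k.
Proof.
move=> uC.
have C0 : 0 <= C.
  have := uC 0%N; rewrite expr0 divr1; apply: le_trans; exact: rnorm_ge0.
have tail k m : (k <= m)%N -> rnorm (u m - u k) <= 2 * C / 2 ^+ k.
  move=> km; have := geometric_cauchy_tail uC km.
  have : 0 <= 2 * C / 2 ^+ m by rewrite divr_ge0 ?mulr_ge0 ?exprn_ge0.
  lra.
have : cvg (u @ \oo).
  apply/cauchy_cvgP/cauchy_exP => -[e e'] /=.
  rewrite ltcE /= => /andP[/eqP -> e0].
  have [k ke] := exists_geometric_lt (2 * C) e0.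
  exists (u k); exists k => // m /= km; rewrite -ball_normE /=.
  by rewrite -rnormE rnorm_distC ltcR (le_lt_trans (tail _ _ km)).
move=> /cvg_ex[l /cvgrPdist_lt ul]; exists l => k.
apply/ler_addgt0Pr => e e0.
have eC0 : 0 < e%:C :> R[i] by rewrite ltcR.
have [m [lm km]] := filter_ex (filterI (ul _ eC0) (nbhs_infty_ge k)).
have := ler_rnormD (l - u m) (u m - u k); rewrite subrKA.
have : rnorm (l - u m) < e by rewrite -ltcR rnormE.
by have := tail _ _ km; lra.
Qed.

Lemma operator_limit (T : nat -> {linear Z -> Y}) (C : R) :
  (forall k z, rnorm (T k.+1 z - T k z) <= C / 2 ^+ k * rnorm z) ->
  exists S : {linear Z -> Y}, forall k z,
    rnorm (S z - T k z) <= 2 * C / 2 ^+ k * rnorm z.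
Proof.
move=> TC.
have /choice[g gP] z : exists l, forall k,
    rnorm (l - T k z) <= 2 * C / 2 ^+ k * rnorm z.
  have [k|l lP] := @geometric_cauchy_cvg (fun k => T k z) (C * rnorm z).
    by rewrite mulrAC TC.
  by exists l => k; rewrite (le_trans (lP k))// mulrA mulrAC.
have [a z w|S SE] := @linear_ex _ Z Y g.
  apply/subr0_eq/rnorm_eq0/eqP; rewrite eq_le rnorm_ge0 andbT.
  apply/ler_addgt0Pr => e e0; rewrite add0r.
  (* Since [T k] is linear, the defect of linearity of [g] is at most [2 C K / 2 ^ k] for every
     [k]. *)
  pose K := rnorm (a *: z + w) + (rnorm (a *: z) + rnorm w).
  have [k ke] := exists_geometric_lt (2 * C * K) e0.
  rewrite (le_trans _ (ltW ke))//.
  have TkE : a *: (g z - T k z) + (g w - T k w) =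
      (a *: g z + g w) - T k (a *: z + w).
    by rewrite linearP scalerBr opprD addrACA.
  have -> : g (a *: z + w) - (a *: g z + g w) =
      (g (a *: z + w) - T k (a *: z + w))
      - (a *: (g z - T k z) + (g w - T k w)).
    by rewrite TkE [in RHS]opprB addrA subrK.
  rewrite (le_trans (ler_rnormB _ _))//.
  have := gP (a *: z + w) k; have := gP w k.
  have := ler_rnormD (a *: (g z - T k z)) (g w - T k w).
  have : rnorm (a *: (g z - T k z)) <= 2 * C / 2 ^+ k * rnorm (a *: z).
    rewrite !rnormZ mulrCA ler_wpM2l// -lecR.
    by rewrite normc_def/= lecR sqrtr_ge0.
  have -> : 2 * C * K / 2 ^+ k = 2 * C / 2 ^+ k * K by rewrite mulrAC.
  by rewrite /K; lra.
by exists S => k z; rewrite SE.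
Qed.

End GeometricLimit.

(** * Improving the norm at a given point of c0 *)

Section C0Operators.
Context {R : realType} {X : normedModType R[i]}.
Implicit Types (x z : c0 X) (u : nat -> X).

Lemma c0_coord_le z i : rnorm (z i) <= rnorm z.
Proof. exact: c0_norm_ub. Qed.

Lemma c0_le z (M : R) : (forall i, rnorm (z i) <= M) -> rnorm z <= M.
Proof. exact: c0_norm_le. Qed.

Lemma c0_ext x z : (forall i, x i = z i) -> x = z.
Proof. by move=> xz; apply/val_inj/funext. Qed.

Lemma c0_finite_support_subproof (N : nat) u :
  (fun i => if (i < N)%N then u i else 0) \in @c0_pred R X.
Proof.
rewrite inE; apply/cvgrPdist_lt => e e0; exists N => // i /= Ni.
by rewrite ltnNge Ni/= rnorm0 subrr normr0.
Qed.

Definition c0_of_finite N u : c0 X := C0 (c0_finite_support_subproof N u).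

Context (N : nat) (F : pred nat) (F_lt : forall i, F i -> (i < N)%N).

(** The cut at [N] puts the sequence in c0; as [F] lies below [N], it alters no coordinate. *)
Definition c0_diag (A : nat -> X -> X) z : c0 X :=
  c0_of_finite N (fun i => if F i then A i (z i) else 0).

Lemma c0_diagE A z i : c0_diag A z i = if F i then A i (z i) else 0.
Proof. by rewrite /=; case: ifPn => // /negP iN; case: ifPn => // /F_lt. Qed.

Lemma c0_diag_linear (A : nat -> X -> X) :
  (forall i, linear (A i)) -> linear (c0_diag A).
Proof.
move=> lA a x z; apply: c0_ext => i.
rewrite [RHS](_ : _ = a *: c0_diag A x i + c0_diag A z i)// !c0_diagE.
by case: ifP => _; [exact: lA|rewrite scaler0 addr0].
Qed.

Lemma c0_diag_le A z (M : R) : 0 <= M ->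
  (forall i, F i -> rnorm (A i (z i)) <= M) -> rnorm (c0_diag A z) <= M.
Proof.
move=> M0 AM; apply: c0_le => i; rewrite c0_diagE.
by case: ifP => [/AM//|_]; rewrite rnorm0.
Qed.

End C0Operators.

Section NormImprovement.
Context {R : realType} {X Y : normedModType R[i]}.
Context (microX : micro_transitive X) (x0 : c0 X) (N : nat) (F : pred nat).
Context (F_lt : forall i, F i -> (i < N)%N).
Context (x0_unit : forall i, F i -> rnorm (x0 i) = 1) (x0_1 : rnorm x0 = 1).
Context (i0 : nat) (Fi0 : F i0).

(** The coordinate projection onto [F]; [n] is the number of elements of [F]. *)
Let P := c0_diag N F (fun=> id : X -> X).
Let n : R := \sum_(0 <= i < N | F i) 1.

(** [phi] sums norming functionals of the [x0 i]. After rotation every summand has real part at most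
    1, so a total within [d] of [n] forces each of them to be within [d] of 1. *)
Lemma averaging_functional : exists phi : c0 X -> R[i],
  [/\ scalar phi, forall z, complex.Re `|phi z| <= n * rnorm z,
      phi x0 = n%:C, forall z, phi (P z) = phi z &
      forall z d, rnorm z <= 1 -> n - d <= complex.Re `|phi z| ->
        exists2 l : R[i], `|l| = 1 &
          forall i, F i -> 2 - d <= rnorm (x0 i + l *: z i)].
Proof.
have /choice[f fP] i := complex_norming_functional (x0 i).
have fD i v w : f i (v + w) = f i v + f i w.
  by have [sf _ _] := fP i; exact: scalar_funD.
have fZ i a v : f i (a *: v) = a * f i v.
  by have [sf _ _] := fP i; exact: scalar_funZ.
have Re_f i v : complex.Re (f i v) <= rnorm v.
  have [_ fle _] := fP i; rewrite (le_trans (ler_Re_norm _))//.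
  by rewrite -lecR rnormE Re_normE.
pose phi z := \sum_(0 <= i < N | F i) f i (z i).
exists phi; split.
- move=> a z w; rewrite /phi mulr_sumr -big_split/=.
  by apply: eq_bigr => i _; rewrite fD fZ.
- move=> z; rewrite -lecR.
  rewrite Re_normE (le_trans (ler_norm_sum _ _ _))//.
  rewrite rmorphM/= /n raddf_sum mulr_suml.
  apply: ler_sum => i _; have [_ fle _] := fP i.
  by rewrite (le_trans (fle _))// -rnormE mul1r lecR c0_coord_le.
- rewrite /phi /n raddf_sum; apply: eq_bigr => i Fi.
  by have [_ _ ->] := fP i; rewrite -rnormE x0_unit.
- move=> z; rewrite /phi; apply: eq_bigr => i Fi.
  by rewrite (c0_diagE F_lt) Fi.
move=> z d z1 phiz; have [l l1 lz] := complex_phase (phi z).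
exists l => // i Fi.
have : n - d <= \sum_(0 <= j < N | F j) complex.Re (f j (l *: z j)).
  rewrite -raddf_sum/= (_ : \sum_(0 <= j < N | F j) _ = `|phi z|)// -lz.
  by rewrite /phi mulr_sumr; apply: eq_bigr => j _; rewrite fZ.
have fz1 j : complex.Re (f j (l *: z j)) <= 1.
  by rewrite (le_trans (Re_f _ _))// rnormZ_unit// (le_trans (c0_coord_le _ _)).
have iN : (i < N)%N by exact: F_lt.
rewrite !big_mkord (bigD1 (Ordinal iN))//= /n big_mkord (bigD1 (Ordinal iN))//=.
have : \sum_(j < N | F j && (j != Ordinal iN)) complex.Re (f j (l *: z j)) <=
    \sum_(j < N | F j && (j != Ordinal iN)) 1 by apply: ler_sum => j _.
have := Re_f i (x0 i + l *: z i).
have -> : complex.Re (f i (x0 i + l *: z i)) = 1 + complex.Re (f i (l *: z i)).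
  have [_ _ fx] := fP i; rewrite fD fx raddfD/=; congr (_ + _); exact: x0_unit.
by rewrite /=; lra.
Qed.

Let n_ge1 : 1 <= n.
Proof.
have iN := F_lt Fi0; rewrite /n big_mkord (bigD1 (Ordinal iN))//=.
by rewrite lerDl sumr_ge0.
Qed.

(** The class on which the iteration runs: contractions that depend only on the coordinates in
    [F]. *)
Definition near_norming (eta : R) (T : {linear c0 X -> Y}) :=
  [/\ forall z, rnorm (T z) <= rnorm z, forall z, T (P z) = T z &
      1 - eta <= rnorm (T x0)].

Lemma rnorm_P_le z : rnorm (P z) <= rnorm z.
Proof.
by apply: (c0_diag_le F_lt) => [|i _]; rewrite ?rnorm_ge0 ?c0_coord_le.
Qed.

(* [z] is the midpoint of the vector with normalized coordinates and of its
   mirror image, which is still in the unit ball. *)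
Lemma norming_unit_coordinates (T : {linear c0 X -> Y}) (M k : R) (z : c0 X) :
  (forall w, rnorm (T w) <= M * rnorm w) -> (forall w, T (P w) = T w) ->
  0 <= M ->
  rnorm z <= 1 -> (forall i, F i -> 0 < rnorm (z i)) -> M - k <= rnorm (T z) ->
  exists v : c0 X, [/\ rnorm v <= 1, forall i, F i -> rnorm (v i) = 1,
    forall i, ~~ F i -> v i = 0 & M - 2 * k <= rnorm (T v)].
Proof.
move=> TM TP M0 z1 z_gt0 Tz.
pose v := c0_diag N F (fun _ u => (rnorm u)^-1%:C *: u) z.
have vE i : v i = if F i then (rnorm (z i))^-1%:C *: z i else 0.
  exact: c0_diagE.
have v1 i : F i -> rnorm (v i) = 1.
  move=> Fi; rewrite vE Fi rnormZ_nneg ?invr_ge0 ?rnorm_ge0// mulVf//.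
  by rewrite gt_eqF// z_gt0.
have v0 i : ~~ F i -> v i = 0 by move=> nFi; rewrite vE (negPf nFi).
have v_le : rnorm v <= 1.
  apply: c0_le => i; have [Fi|nFi] := boolP (F i); first by rewrite v1.
  by rewrite v0// rnorm0.
exists v; split => //.
have mirror_le : rnorm (P z + P z - v) <= 1.
  apply: c0_le => i.
  rewrite (_ : (_ : c0 X) i = P z i + P z i - v i)// vE /P (c0_diagE F_lt).
  have [Fi|_] := boolP (F i); last by rewrite !addr0 subr0 rnorm0.
  have u1 : rnorm (z i) <= 1 by rewrite (le_trans (c0_coord_le z i)).
  move: (z i) (z_gt0 i Fi) u1 => u u0 u1.
  have -> : u + u - (rnorm u)^-1%:C *: u = (2 - (rnorm u)^-1)%:C *: u.
    by rewrite rmorphB scalerBl -[2]/(1 + 1) rmorphD scalerDl scale1r.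
  rewrite rnormZ_real -{2}(gtr0_norm u0) -normrM mulrBl mulVf ?gt_eqF//.
  by rewrite ler_norml; apply/andP; split; lra.
have := ler_rnormD (T v) (T (P z + P z - v)).
rewrite -linearD addrC subrK linearD TP.
have -> : T z + T z = 2%:C *: T z.
  by rewrite -[2]/(1 + 1) rmorphD scalerDl scale1r.
rewrite rnormZ_nneg//.
have : rnorm (T (P z + P z - v)) <= M by rewrite (le_trans (TM _))// ler_piMr.
lra.
Qed.

(** Micro-transitivity provides one [th] for all coordinates; [W] is diagonal, with an isometry of
    [X] at each place of [F]. *)
Lemma coordinatewise_isometry (e : R) : 0 < e -> exists2 th : R, 0 < th &
  forall v : c0 X, (forall i, F i -> rnorm (v i) = 1) ->
    (forall i, ~~ F i -> v i = 0) ->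
    (forall i, F i -> rnorm (x0 i - v i) < th) ->
  exists W : {linear c0 X -> c0 X}, [/\ forall w, rnorm (W w) <= rnorm w,
    forall w, W (P w) = W w, W x0 = v &
    forall w, rnorm (W w - P w) <= e * rnorm w].
Proof.
move=> e0; have [th th0 thP] := micro_transitiveE microX e0.
exists th => // v v1 v0 x0v.
have /choice[U UP] i : exists U : {linear X -> X}, F i ->
    [/\ forall u, rnorm (U u) = rnorm u, U (x0 i) = v i &
        forall u, rnorm (U u - u) <= e * rnorm u].
  have [Fi|_] := boolP (F i); last by exists idfun.
  have [U isoU [Ux UI]] := thP _ _ (x0_unit Fi) (v1 i Fi) (x0v i Fi).
  by exists U.
have lU : linear (c0_diag N F (fun i => U i)).
  by apply: c0_diag_linear => // i a u w; rewrite linearP.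
have [W WE] := linear_ex lU.
have {}WE w i : W w i = if F i then U i (w i) else 0.
  by rewrite WE; exact: c0_diagE.
have PE w i : P w i = if F i then w i else 0 by exact: c0_diagE.
exists W; split.
- move=> w; apply: c0_le => i; rewrite WE; case: ifPn => [Fi|_].
    by have [-> _ _] := UP i Fi; exact: c0_coord_le.
  by rewrite rnorm0 rnorm_ge0.
- by move=> w; apply: c0_ext => i; rewrite !WE PE; case: (F i).
- apply: c0_ext => i; rewrite WE; case: ifPn => [Fi|nFi]; last by rewrite v0.
  by have [] := UP i Fi.
move=> w; apply: c0_le => i; rewrite (_ : (_ : c0 X) i = W w i - P w i)// WE PE.
case: ifPn => [Fi|_]; last by rewrite subr0 rnorm0 mulr_ge0 ?rnorm_ge0// ltW.
by have [_ _ UI] := UP i Fi; rewrite (le_trans (UI _))// ler_pM2l ?c0_coord_le.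
Qed.

(* Adding to [T] a small multiple of [phi (.) T x0] makes [x0] strongly exposed
   up to rotation: whatever almost norms the perturbed operator is close to the
   circle through [x0] in every coordinate of [F]. *)
Lemma exposing_perturbation (e d : R) : 0 < e -> e <= 1 -> 0 < d ->
  exists2 eta : R, 0 < eta & forall T, near_norming eta T ->
  exists (T' : {linear c0 X -> Y}) (M : R),
    [/\ forall z, T' (P z) = T' z, forall z, rnorm (T' z - T z) <= e * rnorm z,
        `|1 - M| <= e, forall z, rnorm (T' z) <= M * rnorm z &
        (forall k, 0 < k -> exists2 z, rnorm z <= 1 & M - k < rnorm (T' z)) /\
        forall z : c0 X, rnorm z <= 1 -> M - eta <= rnorm (T' z) ->
          exists2 l : R[i], `|l| = 1 &
            forall i, F i -> 2 - d <= rnorm (x0 i + l *: z i)].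
Proof.
move=> e0 e1 d0.
(* [phi] is bounded by [n], so the perturbation has norm at most [e]. *)
pose r := e / n.
have n0 : 0 < n by have := n_ge1; lra.
have r0 : 0 < r by rewrite divr_gt0.
have rn : r * n = e by rewrite /r divfK ?gt_eqF.
(* If [z] almost norms [T1], then [r |phi z| >= M - eta - 1 >= e - 3 eta], which is at least
   [r (n - d)]. *)
pose eta := Num.min e (r * d / 3).
have rd0 : 0 < r * d by rewrite mulr_gt0.
have eta0 : 0 < eta by rewrite lt_min e0 divr_gt0.
have eta_e : eta <= e by rewrite ge_min lexx.
have eta_rd : 3 * eta <= r * d by rewrite mulrC -ler_pdivlMr// ge_min lexx orbT.
move: eta eta0 eta_e eta_rd => eta eta0 eta_e eta_rd.
exists eta => // T [T_le TP Tx0].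
have [phi [sphi phi_le phi_x0 phiP phi_near]] := averaging_functional.
have [|T1 T1E] := @linear_ex _ _ _ (fun z => T z + (r%:C * phi z) *: T x0).
  move=> a z w; rewrite sphi linearP scalerDr scalerA addrACA mulrDr scalerDl.
  by rewrite mulrCA.
have x0_le : rnorm (T x0) <= 1 by rewrite (le_trans (T_le _)) ?x0_1.
have T1T_phi z : rnorm (T1 z - T z) <= r * complex.Re `|phi z|.
  rewrite T1E addrC addKr -scalerA rnormZ_nneg ?(ltW r0)// rnormZ mulrA ler_piMr//.
  by rewrite mulr_ge0 ?(ltW r0) ?Re_norm_ge0.
have T1T z : rnorm (T1 z - T z) <= e * rnorm z.
  by rewrite (le_trans (T1T_phi z))// -rn -mulrA ler_pM2l.
have T1_phi z : rnorm (T1 z) <= rnorm z + r * complex.Re `|phi z|.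
  by rewrite -[T1 z](subrKC (T z)) (le_trans (ler_rnormD _ _)) ?lerD ?T_le ?T1T_phi.
have T1_le z : rnorm (T1 z) <= (1 + e) * rnorm z.
  rewrite -[T1 z](subrKC (T z)) (le_trans (ler_rnormD _ _))//.
  by rewrite mulrDl mul1r lerD ?T_le ?T1T.
have e1_gt0 : 0 < 1 + e by rewrite addr_gt0.
have [M T1M M_sup] := operator_norm_ex T1_le.
have M_lo : (1 + e) * (1 - eta) <= M.
  have := T1M x0; rewrite x0_1 mulr1 T1E phi_x0 -rmorphM rn -{1}[T x0]scale1r.
  rewrite -scalerDl -rmorphD rnormZ_nneg ?(ltW e1_gt0)//.
  by apply: le_trans; rewrite ler_pM2l.
have M_hi : M <= 1 + e.
  apply/ler_addgt0Pr => k k0; have [z z1 zM] := M_sup _ k0.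
  rewrite -lerBlDr (le_trans (ltW zM))// (le_trans (T1_le z))//.
  by rewrite ler_piMr// ltW.
have eta_ee : e * eta <= eta by rewrite ger_pMl.
exists T1, M; split => //.
- by move=> z; rewrite !T1E TP phiP.
- by rewrite ler_norml; apply/andP; split; lra.
split=> // z z1 zM; apply: phi_near => //; rewrite -(ler_pM2l r0) mulrBr rn.
have := T1_phi z.
lra.
Qed.

(** [T'] is [M^-1 T1 W], where [T1] is the exposing perturbation, of norm [M], and [W] sends [x0] to
    a rotation of a vector [v] almost norming [T1]. As [eta] is fixed before [eta'], the step can be
    iterated. *)
Lemma norm_improvement (e : R) : 0 < e -> e <= 1 -> exists2 eta : R, 0 < eta &
  forall T, near_norming eta T -> forall eta', 0 < eta' ->
  exists2 T', near_norming eta' T' &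
    forall z, rnorm (T' z - T z) <= e * rnorm z.
Proof.
move=> e0 e1.
have e4 : 0 < e / 4 by rewrite divr_gt0.
have e4_le : e / 4 <= 4^-1 by rewrite ler_piMl.
have [th th0 thP] := coordinatewise_isometry e4.
have [d1 d10 d1P] := micro_transitive_midpoint microX th0.
(* [d <= 2^-1] keeps the coordinates of [z] in [F] away from 0. *)
pose d := Num.min d1 2^-1.
have d0 : 0 < d by rewrite lt_min d10 invr_gt0/=.
have dd1 : d <= d1 by rewrite ge_min lexx.
have d2 : d <= 2^-1 by rewrite ge_min lexx orbT.
have [|eta eta0 etaP] := @exposing_perturbation (e / 4) d e4 _ d0.
  by rewrite (le_trans e4_le)// invf_le1// ler1n.
exists eta => // T nT eta' eta'0; have [T_le TP Tx0] := nT.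
have [T1 [M [T1P T1T M_1 T1M [M_sup near]]]] := etaP T nT.
have M0 : 0 < M by move: M_1; rewrite ler_norml => /andP[]; lra.
(* Normalizing the coordinates doubles the loss [k]: [2 k <= eta] lets [near] apply to [v], and
   [2 k <= M eta'] gives the final precision after division by [M]. *)
pose k := Num.min (eta / 2) (M * eta' / 2).
have k0 : 0 < k by rewrite lt_min !divr_gt0// mulr_gt0.
have k_eta : 2 * k <= eta by rewrite mulrC -ler_pdivlMr// ge_min lexx.
have k_eta' : 2 * k <= M * eta' by rewrite mulrC -ler_pdivlMr// ge_min lexx orbT.
have [z z1 zM] := M_sup _ k0.
have [|l l1 lz] := near z z1.
  by lra.
have z_gt0 i : F i -> 0 < rnorm (z i).
  move=> Fi; have := lz i Fi; have := ler_rnormD (x0 i) (l *: z i).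
  by rewrite rnormZ_unit// x0_unit//; lra.
have [v [v_le v1 v0 vM]] :=
  norming_unit_coordinates T1M T1P (ltW M0) z1 z_gt0 (ltW zM).
(* The first use of [near] served to make the coordinates nonzero; this one supplies the phase
   bringing [v] close to [x0]. *)
have [|l' l'1 l'v] := near _ v_le.
  by apply: le_trans vM; rewrite lerD2l lerN2.
have l'v1 i : F i -> rnorm (l' *: v i) = 1.
  by move=> Fi; rewrite rnormZ_unit// v1.
have [|||W [W_le WP Wx0 W_P]] := thP (l' *: v).
- exact: l'v1.
- by move=> i nFi; rewrite -(scaler0 _ l') -(v0 i nFi).
- move=> i Fi; apply: d1P; rewrite ?x0_unit//; first by rewrite l'v1.
  by apply: le_trans (l'v i Fi); rewrite lerD2l lerN2.
have MV0 : 0 < M^-1 by rewrite invr_gt0.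
have [|T2 T2E] := @linear_ex _ _ _ (fun z => M^-1%:C *: T1 (W z)).
  by move=> a u w; rewrite [W _]linearP [T1 _]linearP scalerDr !scalerA mulrC.
have T2_norm w : rnorm (T2 w) = M^-1 * rnorm (T1 (W w)).
  by rewrite T2E rnormZ_nneg// ltW.
exists T2; first split.
- by move=> w; rewrite T2_norm ler_pdivrMl// (le_trans (T1M _))// ler_pM2l.
- by move=> w; rewrite !T2E WP.
- rewrite T2_norm Wx0 linearZ rnormZ_unit// ler_pdivlMl// (le_trans _ vM)//.
  by rewrite mulrBr mulr1 lerD2l lerN2.
move=> w.
(* Three errors of at most [e / 4] each: replacing [P] by [W], dividing by [M], and perturbing
   [T]. *)
have -> : T2 w - T w =
    M^-1%:C *: (T1 (W w - P w) + (1 - M)%:C *: T1 (P w)) + (T1 w - T w).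
  have -> : T1 (W w - P w) + (1 - M)%:C *: T1 (P w) = T1 (W w) - M%:C *: T1 w.
    by rewrite rmorphB scalerBl scale1r linearB T1P [LHS]addrA subrK.
  rewrite scalerBr -T2E scalerA -rmorphM mulVf ?gt_eqF// scale1r.
  by rewrite addrA subrK.
rewrite (le_trans (ler_rnormD _ _))// rnormZ_nneg ?(ltW MV0)//.
have A : rnorm (T1 (W w - P w)) <= M * (e / 4 * rnorm w).
  by rewrite (le_trans (T1M _))// ler_pM2l.
have B : rnorm ((1 - M)%:C *: T1 (P w)) <= M * (e / 4 * rnorm w).
  by rewrite rnormZ_real mulrCA ler_pM ?rnorm_ge0// T1P.
have C : M^-1 * rnorm (T1 (W w - P w) + (1 - M)%:C *: T1 (P w)) <=
    2 * (e / 4 * rnorm w).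
  rewrite ler_pdivrMl// mulrCA (le_trans (ler_rnormD _ _))//.
  by rewrite mulr_natl mulr2n lerD.
have D : 0 <= e / 4 * rnorm w by rewrite mulr_ge0 ?rnorm_ge0// ltW.
by move: {A B} (T1T w) C D; lra.
Qed.

End NormImprovement.

(** * The coordinates at which [x0] has norm one *)

Section UnitCoordinates.
Context {R : realType} {X : normedModType R[i]}.
Context (x0 : c0 X) (x0_1 : rnorm x0 = 1).
Let F : pred nat := fun i => rnorm (x0 i) == 1.

(** Beyond some [N] the coordinates are below [2^-1]; below [N] there are finitely many gaps, and
    their minimum is positive. *)
Lemma unit_coordinates_gap : exists N (b : R),
  [/\ 0 < b, forall i, F i -> (i < N)%N &
      forall i, ~~ F i -> rnorm (x0 i) <= 1 - b].
Proof.
have [N _ NP] : \forall i \near \oo, rnorm (x0 i) < 2^-1.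
  have /cvgrPdist_lt/(_ 2^-1)[|N _ NP] := c0_cvg x0; first by rewrite invr_gt0.
  exists N => // i /= Ni; have := NP i Ni.
  by rewrite /= sub0r normrN ger0_norm// rnorm_ge0.
have [b b0 bP] : exists2 b : R, 0 < b &
    forall i, (i < N)%N -> ~~ F i -> rnorm (x0 i) <= 1 - b.
  elim: (N) => [|n [b b0 bP]]; first by exists 1.
  have [Fn|nFn] := boolP (F n).
    by exists b => // i; rewrite ltnS leq_eqVlt => /predU1P[->|/bP//]; rewrite Fn.
  have xn : rnorm (x0 n) < 1.
    by rewrite lt_neqAle nFn -x0_1 c0_coord_le.
  exists (Num.min b (1 - rnorm (x0 n))); first by rewrite lt_min b0 subr_gt0.
  move=> i; rewrite ltnS leq_eqVlt lerBrDr -lerBrDl ge_min.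
  move=> /predU1P[->|/bP ib /ib].
    by move=> _; apply/orP; right; lra.
  by move=> ?; apply/orP; left; lra.
exists N, (Num.min b 2^-1); split.
- by rewrite lt_min b0 /=; lra.
- move=> i Fi; rewrite ltnNge; apply/negP => Ni.
  by have := NP i Ni; rewrite /= (eqP Fi); lra.
- move=> i nFi; rewrite lerBrDr -lerBrDl ge_min; apply/orP.
  have [iN|Ni] := ltnP i N; first by left; have := bP i iN nFi; lra.
  by right; have := NP i Ni; rewrite /=; lra.
Qed.

Lemma unit_coordinate_ex : exists i, F i.
Proof.
have [N [b [b0 _ bP]]] := unit_coordinates_gap.
apply: contrapT => nF; have : rnorm x0 <= 1 - b.
  by apply: c0_le => i; apply: bP; apply/negP => Fi; apply: nF; exists i.
by rewrite x0_1; lra.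
Qed.

(* Perturbing [x0] by a small multiple of a vector supported where [x0] is
   strictly inside the unit ball stays in the ball, so C-uniform convexity at
   the almost extreme point [T x0] forces [T] to be small on such vectors. *)
Lemma small_off_unit_coordinates (Y : normedModType R[i]) :
  C_uniformly_convex Y -> forall e : R, 0 < e -> exists2 eta : R, 0 < eta &
  forall T : {linear c0 X -> Y}, (forall z, rnorm (T z) <= rnorm z) ->
    1 - eta < rnorm (T x0) ->
    forall w : c0 X, (forall i, F i -> w i = 0) -> rnorm (T w) <= e * rnorm w.
Proof.
move=> cY e e0; have [N [b [b0 _ bP]]] := unit_coordinates_gap.
have [d d0 dP] := C_uniformly_convexE cY (mulr_gt0 b0 e0).
have d1 : 0 < 1 + d by lra.
(* [1 - d / (1 + d)] is the inverse of [1 + d]. *)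
exists (d / (1 + d)) => [|T T_le Tx0 w wF]; first by rewrite divr_gt0.
have {}Tx0 : 1 < (1 + d) * rnorm (T x0).
  rewrite mulrC -ltr_pdivrMr//; apply: le_lt_trans Tx0.
  rewrite le_eqVlt; apply/orP; left; apply/eqP.
  by field; lra.
rewrite leNgt; apply/negP => Tw.
set p := rnorm (T x0) in Tx0 *; set q := rnorm (T w) in Tw *.
have p0 : 0 < p by rewrite -(pmulr_rgt0 _ d1) (lt_trans ltr01).
have q0 : 0 < q by rewrite (le_lt_trans _ Tw)// mulr_ge0 ?rnorm_ge0// ltW.
have p1 : p <= 1 by rewrite -x0_1 T_le.
have unit_norm (v : Y) : 0 < rnorm v -> rnorm ((rnorm v)^-1%:C *: v) = 1.
  by move=> v0; rewrite rnormZ_nneg ?invr_ge0 ?ltW// mulVf// gt_eqF.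
have [l l1 lP] := dP _ _ (unit_norm _ p0) (unit_norm _ q0).
(* [q > e |w|] and [p <= 1] give [c |w| <= b], so the perturbed point stays in the ball; its image
   is [p] times a unit vector plus [l b e] times another. *)
pose c := b * e * p / q.
have c_gt0 : 0 < c by rewrite divr_gt0// !mulr_gt0.
have xw : rnorm (x0 + (l * c%:C) *: w) <= 1.
  apply: c0_le => i; rewrite (_ : (_ : c0 X) i = x0 i + (l * c%:C) *: w i)//.
  have [Fi|nFi] := boolP (F i); first by rewrite wF// scaler0 addr0 (eqP Fi).
  rewrite (le_trans (ler_rnormD _ _))// -scalerA rnormZ_unit// rnormZ_nneg ?(ltW c_gt0)//.
  have : c * rnorm (w i) <= c * rnorm w by rewrite ler_pM2l// c0_coord_le.
  have : c * rnorm w <= b.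
    rewrite /c mulrAC ler_pdivrMr//.
    have : b * p * (e * rnorm w) <= b * p * q by rewrite ler_pM2l ?mulr_gt0// ltW.
    have : b * p * q <= b * 1 * q by rewrite ler_pM2r// ler_pM2l.
    lra.
  have := bP i nFi; lra.
have := T_le (x0 + (l * c%:C) *: w).
have -> : T (x0 + (l * c%:C) *: w) = p%:C *:
    ((p^-1)%:C *: T x0 + (l * (b * e)%:C) *: ((q^-1)%:C *: T w)).
  rewrite linearD linearZ scalerDr !scalerA -rmorphM divff ?gt_eqF// scale1r.
  congr (_ + _ *: _); rewrite mulrCA -!mulrA -!rmorphM; congr (_ * _%:C).
  by rewrite /c; ring.
rewrite rnormZ_nneg ?(ltW p0)// => Txw.
have : p * (1 + d) < 1 by rewrite (lt_le_trans _ (le_trans Txw xw))// ltr_pM2l.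
lra.
Qed.

End UnitCoordinates.

(** * The iteration and its limit *)

Theorem theorem2p7 (R : realType) (X Y : completeNormedModType R[i])
    (hX : micro_transitive X) (hY : C_uniformly_convex Y) :
  property_Lpp (c0 X) Y.
Proof.
move=> e e0 x0 x0_1.
have [N [b [_ F_lt _]]] := unit_coordinates_gap x0_1.
have [i0 Fi0] := unit_coordinate_ex x0_1.
set F : pred nat := fun i => rnorm (x0 i) == 1 in F_lt Fi0.
have x0_unit i : F i -> rnorm (x0 i) = 1 by move=> /eqP.
pose P := c0_diag N F (fun=> id : X -> X).
have P_le z : rnorm (P z) <= rnorm z by exact: rnorm_P_le.
(* The steps add up to at most [2 C <= e / 4], and restricting to [F] costs another [e / 4]. *)
pose C := Num.min e 1 / 8.
have C0 : 0 < C by rewrite divr_gt0// lt_min e0 ltr01.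
have Ce : C <= e / 8 by rewrite ler_pM2r// ge_min lexx.
have C1 : C <= 1 by rewrite ler_pdivrMr// ge_min; apply/orP; right; lra.
have /choice[eta etaP] k : exists eta : R, 0 < eta /\
    forall T : {linear c0 X -> Y}, near_norming x0 N F eta T ->
    forall eta', 0 < eta' ->
    exists2 T' : {linear c0 X -> Y}, near_norming x0 N F eta' T' &
      forall z, rnorm (T' z - T z) <= C / 2 ^+ k * rnorm z.
  have [||eta eta0 etaP] := norm_improvement (Y := Y) hX F_lt x0_unit x0_1 Fi0
    (e := C / 2 ^+ k).
  - by rewrite divr_gt0// exprn_gt0.
  - by rewrite ler_pdivrMr ?exprn_gt0// mul1r (le_trans C1)// exprn_ege1// ler1n.
  by exists eta.
(* [eta k] is what the improvement number [k] requires; [2 ^- k] makes the precision tend to 0. *)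
pose et k := Num.min (eta k) (2 ^- k).
have et0 k : 0 < et k by rewrite lt_min (etaP k).1 invr_gt0 exprn_gt0.
have near_le (T : {linear c0 X -> Y}) a a' : a <= a' ->
    near_norming x0 N F a T -> near_norming x0 N F a' T.
  by move=> aa' [T_le TP Tx0]; split => //; lra.
have /choice[next nextP] (kT : nat * {linear c0 X -> Y}) :
    exists T' : {linear c0 X -> Y}, near_norming x0 N F (et kT.1) kT.2 ->
      near_norming x0 N F (et kT.1.+1) T' /\
      forall z, rnorm (T' z - kT.2 z) <= C / 2 ^+ kT.1 * rnorm z.
  (* [next] is total; an operator that is not near-norming is returned unchanged. *)
  have [nT|] := pselect (near_norming x0 N F (et kT.1) kT.2); last first.
    by exists kT.2.
  have [|T' nT' T'T] := (etaP kT.1).2 kT.2 _ _ (et0 kT.1.+1).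
    by apply: near_le nT; rewrite ge_min lexx.
  by exists T'.
(* One half of [et 0] covers the defect of [T] at [x0], the other the passage from [T] to [T0]. *)
pose e1 := Num.min (e / 4) (et 0%N / 2).
have e10 : 0 < e1 by rewrite lt_min !divr_gt0.
have [eta1 eta10 eta1P] := small_off_unit_coordinates x0_1 hY e10.
have eta_pos : 0 < Num.min eta1 (et 0%N / 2).
  by rewrite lt_min eta10 divr_gt0.
exists (Num.min eta1 (et 0%N / 2)); split => // T T_sphere Tx0.
have T_le := op_sphere_rnorm_le T_sphere.
have [T0 T0E] : exists T0 : {linear c0 X -> Y}, forall z, T0 z = T (P z).
  apply: linear_ex => a z w; rewrite (_ : P _ = a *: P z + P w) ?linearP//.
  exact: c0_diag_linear.
have PE z i : P z i = if F i then z i else 0 by exact: c0_diagE.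
have T0T z : rnorm (T0 z - T z) <= e1 * rnorm z.
  rewrite T0E rnorm_distC -linearB.
  have subPE i : (z - P z) i = z i - P z i by [].
  rewrite (le_trans (eta1P T T_le _ (z - P z) _)) ?ler_pM2l//.
  - move: Tx0; rewrite ltrBlDr -ltrBlDl lt_min => /andP[+ _].
    by rewrite ltrBlDl -ltrBlDr.
  - by move=> i Fi; rewrite subPE PE (_ : F i) ?subrr.
  - apply: c0_le => i; rewrite subPE PE; case: ifP => _.
      by rewrite subrr rnorm0 rnorm_ge0.
    by rewrite subr0 c0_coord_le.
have nT0 : near_norming x0 N F (et 0%N) T0.
  split.
  - by move=> z; rewrite T0E (le_trans (T_le _)).
  - move=> z; rewrite !T0E; congr (T _); apply: c0_ext => i.
    by rewrite !PE; case: (F i).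
  have := T0T x0; rewrite x0_1 mulr1 rnorm_distC => T0x0.
  have := ler_rnormD (T0 x0) (T x0 - T0 x0); rewrite subrKC => Tx0_le.
  have e1_et : e1 <= et 0%N / 2 by rewrite ge_min lexx orbT.
  have min_et : Num.min eta1 (et 0%N / 2) <= et 0%N / 2 by rewrite ge_min lexx orbT.
  by move: Tx0 T0x0 Tx0_le e1_et min_et; lra.
pose Tn := fix Tn k := if k is k'.+1 then next (k', Tn k') else T0.
have nTn k : near_norming x0 N F (et k) (Tn k).
  by elim: k => [//|k IH]; have [] := nextP (k, Tn k) IH.
have TnC k z : rnorm (Tn k.+1 z - Tn k z) <= C / 2 ^+ k * rnorm z.
  by have [_] := nextP (k, Tn k) (nTn k); apply.
have [S SP] := operator_limit TnC.
have S_le z : rnorm (S z) <= rnorm z.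
  apply/ler_addgt0Pr => d d0; have [k kd] := exists_geometric_lt (2 * C * rnorm z) d0.
  rewrite -[S z](subrK (Tn k z)) (le_trans (ler_rnormD _ _))// addrC lerD//.
    by have [Tn_le _ _] := nTn k; exact: Tn_le.
  by rewrite (le_trans (SP k z))// mulrAC ltW.
have Sx0 : rnorm (S x0) = 1.
  apply/eqP; rewrite eq_le -{1}x0_1 S_le/=.
  apply/ler_addgt0Pr => d d0; have [k kd] := exists_geometric_lt (1 + 2 * C) d0.
  have [_ _ Tx0k] := nTn k; have := SP k x0; rewrite x0_1 mulr1 rnorm_distC => SPk.
  have := ler_rnormD (S x0) (Tn k x0 - S x0); rewrite subrKC => Tnx0.
  have etk : et k <= 2 ^- k by rewrite ge_min lexx orbT.
  move: kd; rewrite mulrDl mul1r => kd.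
  by move: Tx0k SPk Tnx0 etk kd; lra.
exists S; split => //; first exact: op_sphere_attained Sx0.
have e2 : 0 <= e / 2 by rewrite divr_ge0// ltW.
have STZ : scalable (S \- T)%R.
  by move=> a z; rewrite scalerBr -[a *: S z]linearZ -[a *: T z]linearZ.
apply: (@le_lt_trans _ _ (e / 2)%:E); last by rewrite lte_fin; lra.
apply/(opnorm_leP STZ e2) => z /=.
have := SP 0%N z; rewrite expr0 divr1 => ST0.
have := ler_rnormD (S z - T0 z) (T0 z - T z); rewrite subrKA => STz.
have e1z : e1 * rnorm z <= e / 4 * rnorm z by rewrite ler_wpM2r ?rnorm_ge0// ge_min lexx.
have Cz : C * rnorm z <= e / 8 * rnorm z by rewrite ler_wpM2r ?rnorm_ge0.
by move: (T0T z) ST0 STz e1z Cz; lra.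
Qed.
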